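(* Let $p=p(n)\in[0,1]$ satisfy $(1-p(n))n^2\to\infty$ as $n\to\infty$, and let $\epsilon>0$. If $p(n)>n^{-\frac12+\epsilon}$, then asymptotically almost surely $\Gamma\in\mathcal{G}(n,p)$ lies in $\mathcal{CFS}$. Conversely, if $p(n)<n^{-\frac12-\epsilon}$, then asymptotically almost surely $\Gamma\in\mathcal{G}(n,p)$ does not lie in $\mathcal{CFS}$.
   Context: Graphs are finite and simple. $\mathcal{G}(n,p)$ is the random graph on $n$ labelled vertices in which each of the $\binom n2$ possible edges is included independently with probability $p=p(n)$. A property holds asymptotically almost surely if its probability tends to $1$ as $n\to\infty$. ''Subgraph'' means induced subgraph. A clique is a complete graph on $t\ge 0$ vertices (the empty graph is a clique). The join $A\star B$ is obtained from $A\sqcup B$ by joining every vertex of $A$ to every vertex of $B$. The square-graph $\square(\Gamma)$ of a graph $\Gamma$ is the graph whose vertices are the induced $4$-cycles of $\Gamma$, with two distinct $4$-cycles joined by an edge if and only if they share a diagonal, i.e. their vertex sets have in common a pair of vertices that are non-adjacent in $\Gamma$ (they may have a third vertex in common). A graph $\Gamma$ belongs to $\mathcal{CFS}$ if $\Gamma=\Gamma'\star K$, where $K$ is a (possibly empty) clique and $\Gamma'$ is a non-empty subgraph such that $\square(\Gamma')$ has a connected component $C$ for which the union of the $4$-cycles in $C$ covers all of $V(\Gamma')$. *)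

(* Defs.v *)
From mathcomp Require Import all_boot all_order all_algebra.

Set Implicit Arguments.
Unset Strict Implicit.
Unset Printing Implicit Defensive.

Record sgraph (V : finType) := SGraph {
  adj : rel V;
  adj_sym : symmetric adj;
  adj_irr : irreflexive adj
}.

Section Graphs.
Variables (V : finType) (G : sgraph V).

Lemma induced_sym (A : {set V}) :
  symmetric (fun x y : {x : V | x \in A} => adj G (val x) (val y)).
Proof. by move=> x y; exact: adj_sym. Qed.

Lemma induced_irr (A : {set V}) :
  irreflexive (fun x y : {x : V | x \in A} => adj G (val x) (val y)).
Proof. by move=> x; exact: adj_irr. Qed.

Definition induced (A : {set V}) : sgraph {x : V | x \in A} :=
  SGraph (@induced_sym A) (@induced_irr A).

Definition is_clique (K : {set V}) : Prop :=
  forall x y, x \in K -> y \in K -> x != y -> adj G x y.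

(* G is the (internal) join of its induced subgraphs on A and B. *)
Definition is_join (A B : {set V}) : Prop :=
  [/\ A :|: B = [set: V], [disjoint A & B]
    & forall x y, x \in A -> y \in B -> adj G x y].

Definition is_component (C : {set V}) : Prop :=
  exists x : V, C = [set y | connect (adj G) x y].

(* An induced 4-cycle is determined by its vertex set. *)
Definition induced_C4 (S : {set V}) : bool :=
  [exists a, exists b, exists c, exists d,
    [&& uniq [:: a; b; c; d], S == [set:: [:: a; b; c; d]],
        adj G a b, adj G b c, adj G c d, adj G d a,
        ~~ adj G a c & ~~ adj G b d]].

Definition share_diagonal (S T : {set V}) : bool :=
  [exists x, exists y,
    [&& x \in S :&: T, y \in S :&: T, x != y & ~~ adj G x y]].

Definition square_adj : rel {S : {set V} | induced_C4 S} :=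
  fun S T => (S != T) && share_diagonal (val S) (val T).

Lemma square_adj_sym : symmetric square_adj.
Proof. by move=> S T; rewrite /square_adj /share_diagonal eq_sym setIC. Qed.

Lemma square_adj_irr : irreflexive square_adj.
Proof. by move=> S; rewrite /square_adj eqxx. Qed.

Definition square : sgraph {S : {set V} | induced_C4 S} :=
  SGraph square_adj_sym square_adj_irr.

End Graphs.

Definition square_covered (V : finType) (G : sgraph V) : Prop :=
  exists C : {set {S : {set V} | induced_C4 G S}},
    is_component (square G) C /\ \bigcup_(S in C) val S = [set: V].

Definition CFS (V : finType) (G : sgraph V) : Prop :=
  exists A K : {set V},
    [/\ is_join G A K, is_clique G K, A != set0
      & square_covered (induced G A)].

Definition pairs (V : finType) : {set {set V}} :=
  [set e : {set V} | #|e| == 2].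

Section GraphOfEdges.
Variables (V : finType) (E : {set {set V}}).

Definition edge_adj : rel V := fun x y => (x != y) && ([set x; y] \in E).

Lemma edge_adj_sym : symmetric edge_adj.
Proof. by move=> x y; rewrite /edge_adj eq_sym setUC. Qed.

Lemma edge_adj_irr : irreflexive edge_adj.
Proof. by move=> x; rewrite /edge_adj eqxx. Qed.

Definition graph_of : sgraph V := SGraph edge_adj_sym edge_adj_irr.

End GraphOfEdges.

(* Imported only here: these libraries shadow the notations of finset. *)
From mathcomp Require Import all_classical all_reals all_analysis.
Import Order.TTheory GRing.Theory Num.Theory.
Import numFieldNormedType.Exports.

Local Open Scope ring_scope.

(* Probability that a sample of G(n, p) satisfies P: the simple graphs on 'I_n
   correspond bijectively, through graph_of, to the subsets E of pairs 'I_n,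
   and each pair belongs to E independently with probability p. *)
Definition gnp_prob (R : realType) (n : nat) (p : R)
    (P : sgraph 'I_n -> Prop) : R :=
  \sum_(E in powerset (pairs 'I_n) | `[< P (graph_of E) >])
    \prod_(e in pairs 'I_n) (if e \in E then p else 1 - p).

Definition aas (R : realType) (p : nat -> R)
    (P : forall n, sgraph 'I_n -> Prop) : Prop :=
  (gnp_prob (p n) (P n) @[n --> \oo] --> (1 : R))%classic.

(* Main.v *)
Require Import Defs.
From mathcomp Require Import all_boot all_order all_algebra.
From mathcomp Require Import boolp.
From mathcomp Require Import ring lra.

(** Call two non-adjacent pairs related when they span a square; the components
of the square-graph are then the components of this relation.

If [p] is small, a covering component lets one add to any vertex set containing
a square a new vertex with two neighbours in the set, so CFS forces, for each
[k], a set of [4 + k] vertices spanning [2 k] edges; a first moment bound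
excludes this when [k] is a large constant.

If [p] is large there are three regimes.
- [p <= 99 / 100]: split the vertices into two halves. In each half, an
  inclusion-maximal matching in a component of the relation is large: a small
  one would have few vertices adjacent to both ends of one of its pairs, since
  there are no large cliques. Given the two halves, the edges between them are
  still independent, and link any two large matchings by a square.
- [p] is close to [1] and [1 - p >= n ^ (- 7 / 4)]: any two non-adjacent pairs
  have a common related pair among their common neighbours.
- [1 - p <= n ^ (- 7 / 4)]: the complement is a matching with at least two
  edges. *)

Set Implicit Arguments.
Unset Strict Implicit.
Unset Printing Implicit Defensive.

(** * Non-adjacent pairs and squares *)

Section Squares.
Variables (V : finType) (G : sgraph V).
Implicit Types (e f : V * V) (S : {set V}).

Definition nonedge e := (e.1 != e.2) && ~~ adj G e.1 e.2.

Definition joined e f :=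
  [&& adj G e.1 f.1, adj G e.1 f.2, adj G e.2 f.1 & adj G e.2 f.2].

(** [e] and [f] are the two diagonals of one induced 4-cycle, so a walk for [drel] runs through
    squares of which consecutive ones share a diagonal. Diagonals are ordered pairs, each occurring
    in both orders. *)
Definition drel : rel (V * V) :=
  fun e f => [&& nonedge e, nonedge f & joined e f].

Definition square_of e f : {set V} := [set:: [:: e.1; f.1; e.2; f.2]].

Lemma drel_sym : symmetric drel.
Proof.
move=> e f; rewrite /drel /joined !(adj_sym G f.1) !(adj_sym G f.2).
by apply/and3P/and3P => -[-> -> /and4P[-> -> -> ->]].
Qed.

Lemma adj_neq x y : adj G x y -> x != y.
Proof. by apply: contraTneq => ->; rewrite adj_irr. Qed.

Lemma drel_C4 e f : drel e f -> induced_C4 G (square_of e f).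
Proof.
case: e f => [a c] [b d] /and3P[/= /andP[/= ac nac] /andP[/= bd nbd]].
case/and4P=> /= ab ad cb cd.
apply/existsP; exists a; apply/existsP; exists b.
apply/existsP; exists c; apply/existsP; exists d.
rewrite /= !inE !negb_or /= eqxx ab (adj_sym G b) cb cd (adj_sym G d) ad nac nbd ac bd.
by rewrite (adj_neq ab) (adj_neq ad) (eq_sym b) (adj_neq cb) (adj_neq cd).
Qed.

(** A non-adjacent pair of a 4-cycle is one of its two diagonals, and the other vertices are the
    ends of the second one. All positions on the cycle are checked. *)
Lemma C4_diagonal S x y v : induced_C4 G S ->
  x \in S -> y \in S -> x != y -> ~~ adj G x y ->
  v \in S -> v != x -> v != y -> adj G v x && adj G v y.
Proof.
case/existsP=> a /existsP[b /existsP[c /existsP[d]]].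
case/and5P=> _ /eqP-> ab bc /and4P[cd da _ _].
rewrite !inE => /or4P[] /eqP-> /or4P[] /eqP->; rewrite ?eqxx // => _;
  rewrite ?(ab, bc, cd, da) // ?(adj_sym G b a, adj_sym G c b,
  adj_sym G d c, adj_sym G a d, ab, bc, cd, da) //;
  move=> _ /or4P[] /eqP->; rewrite ?eqxx // => _ _;
  by rewrite ?(adj_sym G b a, adj_sym G c b, adj_sym G d c, adj_sym G a d,
    ab, bc, cd, da).
Qed.

(** Squares with a common diagonal are equal or adjacent in the square-graph, so a walk of diagonals
    from [e0] lifts to a walk of squares from the square on [e0] and [e1]. *)
Lemma connected_square_covered e0 e1 :
  drel e0 e1 -> (forall v, exists w, connect drel e0 (v, w)) ->
  square_covered G.
Proof.
move=> e01 cov.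
pose sq e f (h : drel e f) : {S : {set V} | induced_C4 G S} :=
  exist _ (square_of e f) (drel_C4 h).
pose S0 := sq _ _ e01.
have step (S T : {S : {set V} | induced_C4 G S}) e : nonedge e ->
    e.1 \in val S -> e.2 \in val S -> e.1 \in val T -> e.2 \in val T ->
    connect (adj (square G)) S T.
  case/andP=> e12 ne12 S1 S2 T1 T2; have [->|ST] := eqVneq S T.
    exact: connect0.
  apply: connect1; rewrite /= /square_adj ST /=.
  apply/existsP; exists e.1; apply/existsP; exists e.2.
  by rewrite !inE S1 S2 T1 T2 e12 ne12.
(* Induction on the walk from its far end: the square of the last step has [e] as second diagonal,
   hence shares it with every square on [e]. *)
have reach e : connect drel e0 e ->
    forall f (h : drel e f), connect (adj (square G)) S0 (sq _ _ h).
  case/connectP=> s; elim/last_ind: s e => [|s e' IH] e /=.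
    move=> _ -> f h; case/and3P: (h) => ne _ _.
    by apply: (step _ _ e0) => //; rewrite !inE eqxx ?orbT.
  rewrite rcons_path last_rcons => /andP[es se'] -> f h.
  apply: connect_trans (IH _ es erefl _ se') _.
  case/and3P: (h) => ne _ _.
  by apply: (step _ _ e') => //; rewrite !inE eqxx ?orbT.
exists [set S | connect (adj (square G)) S0 S]; split; first by exists S0.
apply/setP=> v; rewrite inE; apply/bigcupP.
have [w /connectP[s]] := cov v.
elim/last_ind: s => [|s e' _] /=.
  move=> _ vw; exists S0; first by rewrite inE connect0.
  by rewrite !inE -vw eqxx.
rewrite rcons_path last_rcons => /andP[es se'] vw; subst e'.
(* Read backwards, the last step is a square with first diagonal [(v, w)], the form that [reach]
   expects. *)
have h := se'; rewrite drel_sym in h.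
have cs : connect drel e0 (v, w).
  apply: connect_trans (connect1 se').
  by apply/connectP; exists s.
exists (sq _ _ h); first by rewrite inE; apply: reach.
by rewrite !inE eqxx.
Qed.

End Squares.

(** * Membership in CFS from connected diagonals, and the growth that CFS forces *)

Lemma connect_homo (T T' : finType) (e : rel T) (e' : rel T') (f : T -> T') :
  {homo f : x y / e x y >-> e' x y} ->
  {homo f : x y / connect e x y >-> connect e' x y}.
Proof.
move=> fh x y /connectP[s]; elim: s x => [|z s IH] x /=.
  by move=> _ ->; apply: connect0.
by case/andP=> xz zs yl; apply: connect_trans (connect1 (fh _ _ xz)) (IH _ zs yl).
Qed.

(* The covered part consists of the vertices that are not universal. *)
Lemma CFS_of_connected (V : finType) (G : sgraph V) (e0 e1 : V * V) :
  drel G e0 e1 ->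
  (forall v w, nonedge G (v, w) ->
     exists w', connect (drel G) e0 (v, w')) ->
  CFS G.
Proof.
move=> e01 cov; pose A := [set v | [exists w, nonedge G (v, w)]].
have inA v w : nonedge G (v, w) -> (v \in A) && (w \in A).
  move=> vw; rewrite !inE; apply/andP; split; apply/existsP; first by exists w.
  by exists v; move: vw; rewrite /nonedge /= eq_sym adj_sym.
have univ x y : x \notin A -> x != y -> adj G x y.
  rewrite inE negb_exists => /forallP /(_ y).
  by rewrite /nonedge /= negb_and !negbK => /orP[/eqP->|//]; rewrite eqxx.
have e0A : e0.1 \in A.
  by case/and3P: e01 => h _ _; case/andP: (inA e0.1 e0.2 h).
exists A, (~: A); split.
- split; first exact: setUCr.
    by rewrite -setI_eq0 setICr.
  move=> x y xA; rewrite inE => yA; rewrite adj_sym; apply: univ => //.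
  by apply: contraNneq yA => ->.
- by move=> x y; rewrite inE => xA _; apply: univ.
- by apply/set0Pn; exists e0.1.
(* [x0] is the default value of [insubd], which otherwise is the identity on [A], where all ends of
   non-adjacent pairs lie. *)
pose x0 : {x | x \in A} := exist _ e0.1 e0A.
pose h (e : V * V) := (insubd x0 e.1, insubd x0 e.2).
have hne e : nonedge G e ->
    (val (insubd x0 e.1) = e.1) * (val (insubd x0 e.2) = e.2).
  by move=> ne; case/andP: (inA e.1 e.2 ne) => h1 h2; rewrite !insubdK.
have neh e : nonedge G e -> nonedge (induced G A) (h e).
  by move=> ne; rewrite /nonedge /= -val_eqE !hne.
have hh : {homo h : x y / drel G x y >-> drel (induced G A) x y}.
  move=> e f /and3P[ee ff ef]; apply/and3P; split; [exact: neh|exact: neh|].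
  by rewrite /joined /= !hne.
apply: (connected_square_covered (hh _ _ e01)) => v.
have := valP v; rewrite inE => /existsP[w vw].
have [w' /(connect_homo hh) c] := cov _ _ vw.
exists (insubd x0 w'); suff -> : (v, insubd x0 w') = h (val v, w') by [].
by rewrite /h /= valKd.
Qed.

(** On a walk in the covering component from a square inside [S] to one that is not, the first
    square leaving [S] shares a diagonal with a square inside [S], and its new vertex is adjacent to
    both ends of that diagonal. If [S] already contains the covered part, a missing vertex lies in
    the clique and is joined to all of [A]. *)
Lemma CFS_grow (V : finType) (G : sgraph V) : CFS G ->
  exists2 S0 : {set V}, induced_C4 G S0 &
  forall S : {set V}, S0 \subset S -> S != [set: V] ->
  exists v x y, [/\ v \notin S, x \in S, y \in S & x != y] /\
    (adj G v x && adj G v y).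
Proof.
case=> A [K [[AK dAK jAK] cK A0 [C [[Q ->] cov]]]].
pose im (S : {set {x | x \in A}}) : {set V} := val @: S.
case/existsP: (valP Q) => a /existsP[b /existsP[c /existsP[d]]].
case/and5P=> uQ /eqP eQ ab bc /and4P[cd da nac nbd].
exists (im (val Q)).
  apply/existsP; exists (val a); apply/existsP; exists (val b).
  apply/existsP; exists (val c); apply/existsP; exists (val d).
  move: uQ; rewrite -(map_inj_uniq val_inj) => uQ; apply/and5P; split=> //.
    apply/eqP/setP=> v; rewrite eQ !inE.
    apply/imsetP/idP => [[x]|]; first by rewrite !inE => /or4P[]/eqP-> ->;
      rewrite eqxx ?orbT.
    by case/or4P=> /eqP->; [exists a | exists b | exists c | exists d];
      rewrite ?inE ?eqxx ?orbT.
  exact/and4P.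
move=> S QS SnT.
have QA : forall x, x \in val Q -> val x \in S.
  by move=> x xQ; apply: (subsetP QS); apply: imset_f.
have [AS|/subsetPn[v vA vS]] := boolP (A \subset S).
  have [v vS] : exists v, v \notin S.
    move: SnT; rewrite -subTset => /subsetPn[v _ vS]; by exists v.
  have vK : v \in K.
    have : v \in A :|: K by rewrite AK inE.
    by rewrite inE => /orP[/(subsetP AS)|//]; rewrite (negbTE vS).
  exists v, (val a), (val c); split; last first.
    by rewrite !(adj_sym G v) !jAK //; apply: valP.
  split=> //; [apply: QA; rewrite eQ !inE eqxx ?orbT //.. |].
  apply: contraTneq uQ => /val_inj ->.
  by rewrite /= !inE eqxx ?orbT.
have : exist (fun x => x \in A) v vA \in [set: {x | x \in A}] by rewrite inE.
rewrite -cov => /bigcupP[T]; rewrite inE => /connectP[s ps Tl] vT.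
have nT : ~~ (im (val T) \subset S).
  by apply: contra vS => /subsetP/(_ v); apply; apply/imsetP; exists (exist _ v vA).
move=> {QA eQ uQ ab bc cd da nac nbd cov}.
(* Induction on the walk, keeping its current square [Q] inside [S]; the first step to a square [P]
   not inside [S] yields the vertex. *)
elim: s Q QS ps Tl => [|P s IH] Q QS /=.
  by move=> _ TQ; rewrite -TQ (negbTE nT) in QS.
case/andP=> QP ps Tl.
have [PS|nPS] := boolP (im (val P) \subset S); first exact: IH PS ps Tl.
case/andP: QP => _ /existsP[x /existsP[y]].
rewrite !inE => /and4P[/andP[xQ xP] /andP[yQ yP] xy nxy].
case/subsetPn: nPS => _ /imsetP[u uP ->] uS.
have xS : val x \in S by apply: (subsetP QS); apply: imset_f.
have yS : val y \in S by apply: (subsetP QS); apply: imset_f.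
exists (val u), (val x), (val y); split=> //.
apply: (C4_diagonal (valP P) xP yP xy nxy uP).
  by apply: contraNneq uS => ->.
by apply: contraNneq uS => ->.
Qed.

Lemma subset_of_card (T : finType) (A : {set T}) k : k <= #|A| ->
  exists2 B : {set T}, B \subset A & #|B| = k.
Proof.
rewrite -bin_gt0 -cards_draws card_gt0 => /set0Pn[B].
by rewrite inE => /andP[BA /eqP]; exists B.
Qed.

Lemma leq_card_bigcup (T I : finType) (A : {set I}) (F : I -> {set T}) k :
  (forall i, i \in A -> #|F i| <= k) -> #|\bigcup_(i in A) F i| <= k * #|A|.
Proof.
move=> Fk; rewrite mulnC -sum_nat_const.
elim/big_rec2: _ => [|i n B iA /leq_trans IH]; first by rewrite cards0.
rewrite (leq_trans (leq_card_setU _ _)) // leq_add ?Fk //.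
exact: IH.
Qed.

Definition edges_in (V : finType) (E : {set {set V}}) (S : {set V}) :=
  [set e in E | e \subset S].

(** Each vertex supplied by [CFS_grow] brings two new edges; the count starts from zero, leaving out
    the edges of the initial square. *)
Lemma CFS_dense_subset (V : finType) (E : {set {set V}}) k :
  CFS (graph_of E) -> 4 + k <= #|V| ->
  exists2 S : {set V}, #|S| = 4 + k & 2 * k <= #|edges_in E S|.
Proof.
case/CFS_grow=> S0 C4 grow kV.
suff [S [_ cS eS]] : exists S : {set V},
    [/\ S0 \subset S, #|S| = 4 + k & 2 * k <= #|edges_in E S|] by exists S.
elim: k kV => [_|k IH kV].
  exists S0; split=> //.
  case/existsP: C4 => a /existsP[b /existsP[c /existsP[d]]].
  by case/and3P=> u /eqP-> _; rewrite cardsE (card_uniqP u).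
have [|S [S0S cS eS]] := IH; first by apply: leq_trans kV; rewrite addnS.
have [|v [x [y [[vS xS yS xy]]]]] := grow S S0S.
  by apply: contraTneq kV => ST; rewrite -cardsT -ST cS addnS ltnn.
case/andP=> /andP[vx vxE] /andP[vy vyE].
exists (v |: S); split.
- exact: subset_trans S0S (subsetUr _ _).
- by rewrite cardsU1 vS cS !addnS.
have nin z : [set v; z] \notin edges_in E S.
  rewrite inE; apply: contra vS => /andP[_ /subsetP]; apply.
  by rewrite !inE eqxx.
have sub : [set v; x] |: ([set v; y] |: edges_in E S) \subset
    edges_in E (v |: S).
  apply/subsetP=> e; rewrite !inE => /or3P[/eqP->|/eqP->|].
  - by rewrite vxE; apply/subsetP=> z; rewrite !inE => /orP[]/eqP->;
      rewrite ?eqxx ?xS ?orbT.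
  - by rewrite vyE; apply/subsetP=> z; rewrite !inE => /orP[]/eqP->;
      rewrite ?eqxx ?yS ?orbT.
  by case/andP=> -> eS'; rewrite (subset_trans eS') // subsetUr.
apply: leq_trans (subset_leq_card sub).
rewrite !cardsU1 in_setU1 negb_or !nin /= mulnS !andbT.
suff -> : [set v; x] != [set v; y] by rewrite /= leq_add2l.
apply/eqP=> /setP/(_ x); rewrite !inE eqxx orbT (negbTE xy) orbF.
by move/esym/eqP=> E1; rewrite E1 eqxx in vx.
Qed.

(** * Maximal matchings of non-adjacent pairs *)

Section Matching.
Variables (V : finType) (G : sgraph V) (X : {set V}).
Implicit Types (e f : V * V) (M : {set V * V}) (Y K : {set V}).

Definition inside e := (e.1 \in X) && (e.2 \in X).

Definition drel_in : rel (V * V) :=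
  fun e f => [&& drel G e f, inside e & inside f].

Definition ends e : {set V} := [set e.1; e.2].

Definition matching M :=
  [forall e in M, forall f in M, (e != f) ==> [disjoint ends e & ends f]].

(** Shaped for a matching [M] that cannot be enlarged: [Y] will consist of the at most [2 * #|M|]
    ends of [M] and of at most [m] common neighbours for each pair of [M], and expansion yields a
    further common neighbour. *)
Definition expanding m s : Prop := forall M Y,
  matching M -> (forall e, e \in M -> inside e && (e.1 != e.2)) ->
  0 < #|M| < s -> #|Y| <= (m + 2) * #|M| -> \bigcup_(e in M) ends e \subset Y ->
  exists x e, [/\ x \in X, x \notin Y, e \in M & adj G x e.1 && adj G x e.2].

Definition clique_free m : Prop := forall K, K \subset X -> #|K| = m ->
  exists x y, [/\ x \in K, y \in K, x != y & ~~ adj G x y].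

Lemma connect_drel_in e f : connect drel_in e f -> connect (drel G) e f.
Proof. by apply: (connect_homo (f := id)) => x y /and3P[]. Qed.

Lemma connect_drel_in_nonedge e f : nonedge G e -> inside e ->
  connect drel_in e f -> nonedge G f && inside f.
Proof.
move=> ne ie /connectP[s]; case/lastP: s => [_ ->|s f']; first by rewrite ne.
rewrite rcons_path last_rcons => /andP[_] /and3P[/and3P[_ ? _] _ ?] ->.
exact/andP.
Qed.

(* An inclusion-maximal matching in the component of [e0] has this size:
   the common neighbours of a pair of the matching which the matching misses
   form a clique, so the matching contradicts expansion when it is small. *)
Lemma large_matching m s e0 : 0 < m -> expanding m s -> clique_free m ->
  nonedge G e0 -> inside e0 ->
  exists M, [/\ matching M, forall e, e \in M -> connect drel_in e0 e
              & s <= #|M|].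
Proof.
move=> m0 ex cf ne0 ie0.
pose P M := matching M && [forall e in M, connect drel_in e0 e].
have P0 : P [set e0].
  apply/andP; split.
    apply/forall_inP=> e /set1P->; apply/forall_inP=> f /set1P->.
    by rewrite eqxx.
  by apply/forall_inP=> e /set1P->; apply: connect0.
have [M /maxsetP[/andP[mM /forall_inP cM] maxM] e0M] := maxset_exists P0.
exists M; split=> //; rewrite leqNgt; apply/negP=> Ms.
pose W := \bigcup_(e in M) ends e.
pose T e := [set x in X | [&& x \notin W, adj G x e.1 & adj G x e.2]].
have Mne e : e \in M -> nonedge G e && inside e.
  by move=> eM; apply: connect_drel_in_nonedge (cM _ eM).
(* Among [m] vertices of [T e] two would be non-adjacent; they form a pair related to [e] and
   disjoint from all of [M], against maximality. *)
have Tm e : e \in M -> #|T e| <= m.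
  move=> eM; rewrite leqNgt; apply/negP=> /ltnW/subset_of_card[K KT cK].
  have [|x [y [/(subsetP KT) + /(subsetP KT) + xy nxy]]] := cf K _ cK.
    by apply: subset_trans KT _; apply/subsetP=> x; rewrite inE => /andP[].
  rewrite !inE => /and4P[xX xW x1 x2] /and4P[yX yW y1 y2].
  have [nee iie] := andP (Mne _ eM).
  have exy : drel_in e (x, y).
    apply/and3P; split=> //; last by rewrite /inside xX.
    rewrite /drel nee /nonedge /= xy nxy /joined /=.
    by rewrite !(adj_sym G e.1) !(adj_sym G e.2) x1 x2 y1 y2.
  have dis f : f \in M -> [disjoint ends (x, y) & ends f].
    move=> fM; rewrite -setI_eq0 -subset0; apply/subsetP=> z.
    rewrite inE => /andP[zxy zf].
    have zW : z \in W by apply/bigcupP; exists f.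
    move: zxy; rewrite !inE /= => /orP[]/eqP zE.
      by rewrite -zE zW in xW.
    by rewrite -zE zW in yW.
  have : (x, y) |: M = M.
    apply: maxM; last exact: subsetUr.
    apply/andP; split.
      apply/forall_inP=> f fM; apply/forall_inP=> g gM; apply/implyP=> fg.
      move: fM gM; rewrite !in_setU1 => /orP[/eqP fE|fM] /orP[/eqP gE|gM].
      - by rewrite fE gE eqxx in fg.
      - by rewrite fE dis.
      - by rewrite gE disjoint_sym dis.
      by move/forall_inP: mM => /(_ _ fM)/forall_inP/(_ _ gM)/implyP->.
    apply/forall_inP=> f; rewrite in_setU1 => /orP[/eqP->|/cM//].
    exact: connect_trans (cM _ eM) (connect1 exy).
  move/setP/(_ (x, y)); rewrite setU11 => /esym xyM.
  by case/negP: xW; apply/bigcupP; exists (x, y); rewrite // !inE eqxx.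
have M0 : 0 < #|M| by rewrite card_gt0; apply/set0Pn; exists e0; rewrite -sub1set.
have := ex M (\bigcup_(e in M) T e :|: W) mM.
case=> [e /Mne/andP[/andP[-> _] ->] // | | | | x [e [xX + eM adjx]]].
- by rewrite M0.
- apply: leq_trans (leq_card_setU _ _) _.
  rewrite mulnDl leq_add ?leq_card_bigcup // => e _.
  by rewrite cards2; case: eqP.
- exact: subsetUr.
rewrite inE negb_or => /andP[/bigcupP nT nW]; case: nT; exists e => //.
by rewrite inE xX nW adjx.
Qed.

End Matching.

(** * Three sufficient conditions for CFS, one for each regime of large [p] *)

Lemma CFS_of_halves (V : finType) (G : sgraph V) (X : {set V}) :
  X != set0 -> ~: X != set0 ->
  (forall Z v, Z \in [:: X; ~: X] -> v \in Z ->
     exists2 w, w \in Z & nonedge G (v, w)) ->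
  (forall e f, nonedge G e -> inside X e -> nonedge G f -> inside (~: X) f ->
     connect (drel G) e f) ->
  CFS G.
Proof.
move=> /set0Pn[x xX] /set0Pn[y yX] nb con.
have [x' x'X ne] := nb X x (mem_head _ _) xX.
have cX : ~: X \in [:: X; ~: X] by rewrite !inE eqxx orbT.
have [y' y'X nf] := nb (~: X) y cX yX.
have ef : connect (drel G) (x, x') (y, y').
  by apply: con => //; rewrite /inside /= ?xX ?yX.
(* A walk between pairs in different halves has a first step, which gives an initial square. *)
have [e1 e01] : exists e1, drel G (x, x') e1.
  move: ef => /connectP[[|e1 s] /=]; last by case/andP; exists e1.
  by move=> _ [yE _]; move: yX; rewrite inE yE xX.
have sym := sym_connect_sym (@drel_sym V G).
(* Non-adjacent pairs inside [X] are reached by going to [(y, y')] and back. *)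
apply: (CFS_of_connected e01) => v _ _.
have [vX|vX] := boolP (v \in X).
  have [w wX nvw] := nb X v (mem_head _ _) vX.
  exists w; apply: connect_trans ef _; rewrite sym.
  by apply: con => //; rewrite /inside /= ?vX ?yX.
rewrite -in_setC in vX.
have [w wX nvw] := nb _ v cX vX.
by exists w; apply: con => //; rewrite /inside /= ?vX ?xX.
Qed.

Lemma CFS_of_common_joined (V : finType) (G : sgraph V) e0 :
  nonedge G e0 ->
  (forall e f, nonedge G e -> nonedge G f ->
     exists g, drel G e g && drel G f g) ->
  CFS G.
Proof.
move=> ne0 cj; have [e1 /andP[e01 _]] := cj _ _ ne0 ne0.
apply: (CFS_of_connected e01) => v w vw.
have [g /andP[eg vg]] := cj _ _ ne0 vw; exists w.
apply: connect_trans (connect1 eg) (connect1 _).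
by rewrite drel_sym.
Qed.

(** When every vertex has at most one non-neighbour, which is the last hypothesis, any two disjoint
    non-adjacent pairs span a square. *)
Lemma CFS_of_disjoint_nonedges (V : finType) (G : sgraph V) e0 e1 :
  nonedge G e0 -> nonedge G e1 -> e0.1 \notin ends e1 -> e0.2 \notin ends e1 ->
  (forall x y z, y != z -> nonedge G (x, y) -> adj G x z || (x == z)) ->
  CFS G.
Proof.
move=> ne0 ne1 e01 e02 h.
have neC v w : nonedge G (v, w) -> nonedge G (w, v).
  by rewrite /nonedge /= eq_sym adj_sym.
have join e f : nonedge G e -> nonedge G f -> e.1 \notin ends f ->
    e.2 \notin ends f -> drel G e f.
  move=> ne nf; rewrite !inE !negb_or => /andP[n11 n12] /andP[n21 n22].
  rewrite /drel ne nf /joined.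
  have a := h e.1 e.2 _ _ ne; have b := h e.2 e.1 _ _ (neC _ _ ne).
  have := a f.1 n21; have := a f.2 n22; have := b f.1 n11; have := b f.2 n12.
  by do 4!(case/orP=> [-> | ]; last by rewrite ?(negbTE n11, negbTE n12, negbTE n21, negbTE n22)).
apply: (CFS_of_connected (join _ _ ne0 ne1 e01 e02)) => v w vw.
have uq a b c : nonedge G (a, b) -> nonedge G (a, c) -> b = c.
  move=> ab /andP[/= ac nac]; apply/eqP; apply: contraNT nac => bc.
  by case/orP: (h _ _ _ bc ab) => // /eqP acE; rewrite acE eqxx in ac.
have c01 := connect1 (join _ _ ne0 ne1 e01 e02).
have [vE|v1] := eqVneq v e0.1.
  by exists e0.2; rewrite vE -surjective_pairing connect0.
(* The reversal of [e0] is not related to [e0] but is reached through [e1]; pairs starting outside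
   [e0] are related to it directly. *)
have [vE|v2] := eqVneq v e0.2.
  have := join (e0.2, e0.1) e1 (neC _ _ ne0) ne1 e02 e01.
  rewrite drel_sym => c; exists e0.1; rewrite vE.
  exact: connect_trans c01 (connect1 c).
exists w; apply: connect1; apply: join => //; rewrite !inE /= negb_or eq_sym.
  rewrite v1 /=; apply: contraNneq v2 => e0w.
  by apply/eqP; apply: (uq w); [exact: neC | rewrite -e0w].
rewrite v2 /=; apply: contraNneq v1 => e0w.
by apply/eqP; apply: (uq w); [exact: neC | rewrite -e0w; exact: neC].
Qed.

(** * Random subsets *)

Import Order.TTheory GRing.Theory Num.Theory.

Local Open Scope ring_scope.

Lemma set_ind (T : finType) (P : {set T} -> Prop) :
  P set0 -> (forall x (A : {set T}), x \notin A -> P A -> P (x |: A)) -> forall A, P A.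
Proof.
move=> P0 PU A; move: {2}#|A| (erefl #|A|) => n.
elim: n A => [A /eqP|n IH A cA]; first by rewrite cards_eq0 => /eqP->.
have /set0Pn[x xA] : A != set0 by rewrite -cards_eq0 cA.
rewrite -(setD1K xA); apply: PU; first by rewrite !inE eqxx.
by apply: IH; move: cA; rewrite (cardsD1 x) xA => -[].
Qed.

Section RandomSubset.
Variables (R : realFieldType) (T : finType) (p : R).
Hypothesis p01 : 0 <= p <= 1.
Implicit Types (B E F : {set T}) (P Q : {set T} -> Prop).

Let p_ge0 : 0 <= p. Proof. by case/andP: p01. Qed.
Let p_le1 : p <= 1. Proof. by case/andP: p01. Qed.
Let q_ge0 : 0 <= 1 - p. Proof. by rewrite subr_ge0. Qed.

Definition weight B E : R := \prod_(e in B) (if e \in E then p else 1 - p).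

Definition expect B (f : {set T} -> R) : R :=
  \sum_(E in powerset B) weight B E * f E.

Definition pr B Q : R := expect B (fun E => (`[< Q E >])%:R).

Lemma pr_sum B Q : pr B Q = \sum_(E in powerset B | `[< Q E >]) weight B E.
Proof.
rewrite /pr /expect [LHS](bigID (fun E => `[< Q E >])) /=.
rewrite [X in _ + X]big1 ?addr0; last first.
  by move=> E /andP[_ /negbTE->]; rewrite mulr0.
by apply: eq_bigr => E /andP[_ ->]; rewrite mulr1.
Qed.

Lemma weight_ge0 B E : 0 <= weight B E.
Proof. by apply: prodr_ge0 => e _; case: ifP. Qed.

Lemma eq_expect B f g : (forall E, E \subset B -> f E = g E) ->
  expect B f = expect B g.
Proof. by move=> fg; apply: eq_bigr => E; rewrite inE => /fg->. Qed.

Lemma ler_expect B f g : (forall E, E \subset B -> f E <= g E) ->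
  expect B f <= expect B g.
Proof.
move=> fg; apply: ler_sum => E; rewrite inE => /fg fgE.
by rewrite ler_wpM2l ?weight_ge0.
Qed.

Lemma expectZ B a f : expect B (fun E => a * f E) = a * expect B f.
Proof. by rewrite /expect mulr_sumr; apply: eq_bigr => E _; rewrite mulrCA. Qed.

Lemma expect_sum (I : Type) (r : seq I) (D : pred I) B (f : I -> {set T} -> R) :
  expect B (fun E => \sum_(i <- r | D i) f i E) =
  \sum_(i <- r | D i) expect B (f i).
Proof.
rewrite /expect exchange_big /=; apply: eq_bigr => E _.
by rewrite mulr_sumr.
Qed.

Lemma expect_set0 f : expect set0 f = f set0.
Proof. by rewrite /expect powerset0 big_set1 /weight big_set0 mul1r. Qed.

Lemma expect_setU1 e B f : e \notin B ->
  expect (e |: B) f =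
  p * expect B (fun E => f (e |: E)) + (1 - p) * expect B f.
Proof.
move=> eB; have weightU E : weight (e |: B) E =
    (if e \in E then p else 1 - p) * weight B E.
  by rewrite /weight big_setU1.
rewrite /expect (bigID (fun E => e \in E)) /=; congr (_ + _).
  rewrite mulr_sumr (reindex_onto (fun E => e |: E) (fun E => E :\ e)) /=; last first.
    by move=> E /andP[_ eE]; rewrite setD1K.
  apply: eq_big => [E|E].
    rewrite !inE eqxx andbT.
    apply/andP/idP => [[sE /eqP EE]|EB].
      have eE : e \notin E by rewrite -EE !inE eqxx.
      apply/subsetP=> x xE; have /(subsetP sE) : x \in e |: E by rewrite inE xE orbT.
      by rewrite !inE => /predU1P[xe|//]; rewrite -xe xE in eE.
    rewrite setUS // setU1K //.
    by apply: contra eB; apply: (subsetP EB).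
  case/andP=> /andP[_ _] /eqP EE; rewrite weightU setU11 -!mulrA; congr (_ * _).
  congr (_ * _); apply: eq_bigr => x xB; rewrite !inE.
  by case: eqP => // xe; rewrite -xe xB in eB.
rewrite mulr_sumr; apply: eq_big => [E|E /andP[_ /negbTE eE]]; last first.
  by rewrite weightU eE mulrA.
rewrite !inE; apply/andP/idP => [[sE eE]|EB].
  apply/subsetP=> x xE; have := subsetP sE x xE.
  by rewrite !inE => /predU1P[xe|//]; rewrite -xe xE in eE.
split; first exact: subset_trans EB (subsetUr _ _).
by apply: contra eB; apply: (subsetP EB).
Qed.

(** Fubini for the product measure, exposing the elements of [B1] one at a time. *)
Lemma expect_setU B1 B2 f : [disjoint B1 & B2] ->
  expect (B1 :|: B2) f =
  expect B1 (fun E1 => expect B2 (fun E2 => f (E1 :|: E2))).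
Proof.
elim/set_ind: B1 f => [|e B1 eB1 IH] f dis.
  rewrite set0U expect_set0; apply: eq_expect => E _; by rewrite set0U.
move: dis; rewrite -setI_eq0 setIUl setU_eq0 !setI_eq0.
rewrite (@eq_disjoint1 _ e) => [|x]; last by rewrite inE.
case/andP=> eB2 dis.
rewrite -setUA !expect_setU1 // ?inE ?negb_or ?eB1 //; rewrite !IH //.
congr (_ * _ + _); apply: eq_expect => E1 _; apply: eq_expect => E2 _.
by rewrite setUA.
Qed.

Lemma expect_cst B c : expect B (fun=> c) = c.
Proof.
elim/set_ind: B => [|e B eB IH]; first by rewrite expect_set0.
by rewrite expect_setU1 // IH -mulrDl addrC subrK mul1r.
Qed.

Lemma pr_le B P Q : (forall E, E \subset B -> P E -> Q E) -> pr B P <= pr B Q.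
Proof.
move=> PQ; apply: ler_expect => E EB; rewrite ler_nat.
by case: asboolP => // /(PQ _ EB) QE; case: asboolP.
Qed.

Lemma pr_eq B P Q : (forall E, E \subset B -> P E <-> Q E) -> pr B P = pr B Q.
Proof. by move=> PQ; apply/le_anti/andP; split; apply: pr_le => E /PQ[]. Qed.

Lemma pr_ge0 B Q : 0 <= pr B Q.
Proof. by rewrite pr_sum sumr_ge0 // => E _; apply: weight_ge0. Qed.

Lemma prC B Q : pr B (fun E => ~ Q E) = 1 - pr B Q.
Proof.
rewrite -{1}(expect_cst B 1) /pr /expect -sumrB; apply: eq_bigr => E _.
by rewrite -mulrBr asbool_neg; case: `[< Q E >]; rewrite ?subr0 ?subrr.
Qed.

Lemma pr_union (I : finType) (D : {set I}) B Q (P : I -> {set T} -> Prop) c :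
  (forall E, E \subset B -> Q E -> exists2 i, i \in D & P i E) ->
  (forall i, i \in D -> pr B (P i) <= c) -> pr B Q <= #|D|%:R * c.
Proof.
move=> QP Pc; apply: (@le_trans _ _ (\sum_(i in D) pr B (P i))); last first.
  by rewrite mulr_natl -sumr_const; apply: ler_sum => i /Pc.
rewrite /pr -expect_sum; apply: ler_expect => E EB.
case: asboolP => [/(QP _ EB)[i iD PiE]|_]; last exact: sumr_ge0.
rewrite (bigD1 i) //=; case: asboolP => // _.
by rewrite lerDl sumr_ge0.
Qed.

Lemma pr_or B Q P1 P2 :
  (forall E, E \subset B -> Q E -> P1 E \/ P2 E) ->
  pr B Q <= pr B P1 + pr B P2.
Proof.
move=> QP; rewrite /pr /expect -big_split /=; apply: ler_sum => E; rewrite inE => EB.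
rewrite -mulrDr ler_wpM2l ?weight_ge0 // -natrD ler_nat.
case: asboolP => // /(QP _ EB)[] PE; last by rewrite addnC; case: asboolP.
by case: asboolP.
Qed.

(** If [S] fails the event is empty. This turns the deterministic part of an event into a hypothesis
    while its probability is bounded. *)
Lemma pr_presume B Q (S : Prop) c : 0 <= c ->
  (forall E, E \subset B -> Q E -> S) -> (S -> pr B Q <= c) -> pr B Q <= c.
Proof.
move=> c0 QS; case: (pselect S) => [sS /(_ sS)//|nS _].
rewrite pr_sum big_pred0 // => E; rewrite inE.
by apply/negP=> /andP[EB /asboolP/(QS _ EB)].
Qed.

Lemma pr_cond B1 B2 Q c : [disjoint B1 & B2] ->
  (forall E1, E1 \subset B1 -> pr B2 (fun E2 => Q (E1 :|: E2)) <= c) ->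
  pr (B1 :|: B2) Q <= c.
Proof.
move=> dis Qc; rewrite /pr expect_setU // -[leRHS](expect_cst B1).
exact: ler_expect.
Qed.

Lemma pr_indep B1 B2 Q Q1 Q2 : [disjoint B1 & B2] ->
  (forall E1 E2, E1 \subset B1 -> E2 \subset B2 ->
     Q (E1 :|: E2) <-> Q1 E1 /\ Q2 E2) ->
  pr (B1 :|: B2) Q = pr B1 Q1 * pr B2 Q2.
Proof.
move=> dis QE; rewrite /pr expect_setU // [RHS]mulrC -expectZ.
apply: eq_expect => E1 s1; rewrite mulrC -expectZ; apply: eq_expect => E2 s2.
rewrite -natrM mulnb; congr (_%:R); congr nat_of_bool.
by apply/asboolP/andP => [/(QE _ _ s1 s2)[]|[/asboolP ? /asboolP ?]];
  [split; apply/asboolP | apply/(QE _ _ s1 s2)].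
Qed.

Lemma subset_disjointU (F E1 E2 : {set T}) B2 : [disjoint F & B2] ->
  E2 \subset B2 -> (F \subset E1 :|: E2) = (F \subset E1).
Proof.
move=> dis s2; apply/idP/idP => [/subsetP sF|/subset_trans-> //].
  apply/subsetP=> x xF; move: (sF x xF); rewrite inE => /orP[//|/(subsetP s2) xB].
  by move: dis; rewrite disjoint_sym => /disjointFr/(_ xB); rewrite xF.
exact: subsetUl.
Qed.

Lemma setUDK B F : F \subset B -> F :|: B :\: F = B.
Proof. by move=> FB; rewrite -[RHS](setID B F) (setIidPr FB). Qed.

Lemma disjointDr F B : [disjoint F & B :\: F].
Proof. by rewrite -setI_eq0; apply/eqP/setP=> x; rewrite !inE; case: (x \in F). Qed.

Lemma pr_true B Q : (forall E, E \subset B -> Q E) -> pr B Q = 1.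
Proof.
move=> QB; rewrite -[RHS](expect_cst B); apply: eq_expect => E /QB QE.
by case: asboolP.
Qed.

Lemma pr_subset B F : F \subset B -> pr B (fun E => F \subset E) = p ^+ #|F|.
Proof.
move=> FB; rewrite -(setUDK FB).
rewrite (@pr_indep _ _ _ (fun E => F \subset E) (fun=> True)); last first.
- move=> E1 E2 _ s2; rewrite (subset_disjointU _ (disjointDr F B) s2).
  by split=> [|[]].
- exact: disjointDr.
rewrite [X in _ * X]pr_true // mulr1 pr_sum (big_pred1 F) => [|E].
  by rewrite /weight -prodr_const; apply: eq_bigr => e ->.
by rewrite !inE asboolb eqEsubset.
Qed.

(** Containments of disjoint sets are independent events; the induction splits one [F i] off [B] at
    a time. *)
Lemma pr_avoid (I : finType) (J : {set I}) (F : I -> {set T}) B k :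
  (forall i, i \in J -> F i \subset B) ->
  (forall i, i \in J -> #|F i| = k) ->
  (forall i j, i \in J -> j \in J -> i != j -> [disjoint F i & F j]) ->
  pr B (fun E => forall i, i \in J -> ~~ (F i \subset E)) = (1 - p ^+ k) ^+ #|J|.
Proof.
elim/set_ind: J B => [|i J iJ IH] B sF cF dF.
  by rewrite cards0 expr0 pr_true // => E _ i; rewrite inE.
have Fi : F i \subset B by rewrite sF // setU11.
have Jd j : j \in J -> [disjoint F i & F j].
  move=> jJ; apply: dF; rewrite ?setU11 // ?inE ?jJ ?orbT //.
  by apply: contraNneq iJ => ->.
have JJ j : j \in J -> j \in i |: J by rewrite inE => ->; rewrite orbT.
rewrite -(setUDK Fi) (@pr_indep _ _ _ (fun E => ~ (F i \subset E))
  (fun E => forall j, j \in J -> ~~ (F j \subset E))).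
- rewrite cardsU1 iJ exprS prC pr_subset // cF ?setU11 // IH //.
  + move=> j jJ; rewrite subsetD sF ?JJ // disjoint_sym; exact: Jd.
  + by move=> j /JJ/cF.
  + by move=> j l /JJ jJ /JJ; apply: dF.
- exact: disjointDr.
move=> E1 E2 s1 s2; have e1 := subset_disjointU E1 (disjointDr (F i) B) s2.
have e2 j : j \in J -> (F j \subset E1 :|: E2) = (F j \subset E2).
  move=> jJ; rewrite setUC (@subset_disjointU _ _ _ (F i)) // disjoint_sym.
  exact: Jd.
split=> [h|[h1 h2] j]; last by rewrite !inE => /predU1P[->|jJ];
  [rewrite e1; apply/negP | rewrite e2 // h2].
split; first by apply/negP; rewrite -e1; apply: h; rewrite setU11.
by move=> j jJ; rewrite -e2 //; apply: h; apply: JJ.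
Qed.

Lemma pr_disjoint B F : F \subset B ->
  pr B (fun E => [disjoint F & E]) = (1 - p) ^+ #|F|.
Proof.
move=> FB; rewrite -[in RHS](expr1 p).
rewrite -(@pr_avoid _ F (fun e => [set e]) B 1).
- apply: pr_eq => E _; split=> [/disjointFr dis e eF|h].
    by rewrite sub1set (dis _ eF).
  rewrite -setI_eq0 -subset0; apply/subsetP=> e; rewrite inE => /andP[eF eE].
  by have := h e eF; rewrite sub1set eE.
- by move=> e eF; rewrite sub1set (subsetP FB).
- by move=> e _; rewrite cards1.
by move=> e f _ _ ef; rewrite -setI_eq0 -subset0; apply/subsetP=> x;
  rewrite !inE => /andP[/eqP-> fe]; rewrite fe in ef.
Qed.

End RandomSubset.

(** * Random graphs *)

Lemma leq_bin_exp n k : ('C(n, k) <= n ^ k)%N.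
Proof.
apply: (@leq_trans (n ^_ k)); first by rewrite -bin_ffact leq_pmulr ?fact_gt0.
elim: k => [|k IH]; first by rewrite ffactn0.
by rewrite ffactnSr expnSr leq_mul // leq_subr.
Qed.

Lemma set2_inj (T : finType) (x a b : T) : [set x; a] = [set x; b] -> a = b.
Proof.
move=> E; have : a \in [set x; b] by rewrite -E !inE eqxx orbT.
rewrite !inE => /orP[/eqP ax|/eqP //].
have : b \in [set x; a] by rewrite E !inE eqxx orbT.
by rewrite !inE ax orbb => /eqP.
Qed.

Lemma superset_of_card (T : finType) (A : {set T}) k :
  (#|A| <= k <= #|T|)%N -> exists2 B : {set T}, A \subset B & #|B| = k.
Proof.
case/andP=> Ak kT; have [|B BA cB] := @subset_of_card _ (~: A) (#|T| - k).
  by rewrite cardsCs setCK leq_sub2l.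
exists (~: B); first by rewrite -(setCK A) setCS.
by rewrite cardsCs setCK cB subKn.
Qed.

Lemma balanced_set (V : finType) : exists X : {set V},
  (#|V|./2 <= #|X|)%N /\ (#|V|./2 <= #|~: X|)%N.
Proof.
have [|X _ cX] := @subset_of_card V [set: V] #|V|./2.
  by rewrite cardsT -{2}(odd_double_half #|V|) -addnn addnA leq_addl.
exists X; rewrite cX cardsCs setCK cX; split=> //.
by rewrite -{2}(odd_double_half #|V|) -addnn addnA addnK leq_addl.
Qed.

Section RandomGraph.
Variables (R : realFieldType) (V : finType) (p : R).
Hypothesis p01 : 0 <= p <= 1.
Implicit Types (X Y Z K : {set V}) (M : {set V * V}) (E : {set {set V}}).

Let n := #|V|.
Let p_ge0 : 0 <= p. Proof. by case/andP: p01. Qed.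
Let p_le1 : p <= 1. Proof. by case/andP: p01. Qed.
Let pX_ge0 k : 0 <= p ^+ k. Proof. exact: exprn_ge0. Qed.
Let pX_le1 k : p ^+ k <= 1. Proof. exact: exprn_ile1. Qed.
Let qX_ge0 k : 0 <= 1 - p ^+ k. Proof. by rewrite subr_ge0. Qed.
Let qX_le1 k : 1 - p ^+ k <= 1. Proof. by rewrite gerBl. Qed.

Lemma set2_pairs (x y : V) : x != y -> [set x; y] \in pairs V.
Proof. by rewrite inE cards2 => ->. Qed.

Definition pairs_in X : {set {set V}} := [set e : {set V} | e \subset X & #|e| == 2].

Lemma card_pairs_in X : #|pairs_in X| = 'C(#|X|, 2).
Proof. by rewrite cards_draws. Qed.

Lemma pairs_in_sub X : pairs_in X \subset pairs V.
Proof. by apply/subsetP=> e; rewrite !inE => /andP[]. Qed.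

Lemma pairs_in_clique X E :
  (forall x y, x \in X -> y \in X -> x != y -> adj (graph_of E) x y) ->
  pairs_in X \subset E.
Proof.
move=> cl; apply/subsetP=> e; rewrite inE => /andP[eX /cards2P[x [y [xy eE]]]].
have := cl x y; rewrite /= /edge_adj xy -eE; apply=> //.
  by apply: (subsetP eX); rewrite eE !inE eqxx.
by apply: (subsetP eX); rewrite eE !inE eqxx orbT.
Qed.

Lemma pr_clique m :
  pr p (pairs V) (fun E => ~ clique_free (graph_of E) [set: V] m) <=
  n%:R ^+ m * p ^+ 'C(m, 2).
Proof.
apply: (@le_trans _ _ (#|[set K : {set V} | #|K| == m]|%:R * p ^+ 'C(m, 2))).
  apply: (pr_union p01 (P := fun K E => pairs_in K \subset E)) => [E sE ncf|K].
    apply: contrapT => nK; apply: ncf => K _ cK.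
    apply: contrapT => nxy; apply: nK; exists K; first by rewrite inE cK.
    apply: pairs_in_clique => // x y xK yK xy.
    by apply: contrapT => /negP nadj; apply: nxy; exists x, y.
  rewrite inE => /eqP cK.
  by rewrite pr_subset ?pairs_in_sub // card_pairs_in cK.
rewrite ler_wpM2r // card_draws -natrX ler_nat leq_bin_exp //.
Qed.

Lemma clique_freeS (G : sgraph V) X m :
  clique_free G [set: V] m -> clique_free G X m.
Proof. by move=> cf K _ cK; apply: cf. Qed.

(** * Stars at a vertex and the probability of expansion *)

Definition star_pairs (x : V) Z : {set {set V}} := [set [set x; z] | z in Z].

Lemma card_star_pairs x Z : #|star_pairs x Z| = #|Z|.
Proof. by rewrite card_imset // => a b /set2_inj. Qed.

Lemma star_pairs_sub x Z : x \notin Z -> star_pairs x Z \subset pairs V.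
Proof.
move=> xZ; apply/subsetP=> _ /imsetP[z zZ ->]; apply: set2_pairs.
by apply: contraNneq xZ => ->.
Qed.

Lemma star_pairsP E x Z : x \notin Z ->
  reflect (forall z, z \in Z -> adj (graph_of E) x z) (star_pairs x Z \subset E).
Proof.
move=> xZ; apply: (iffP subsetP) => [sE z zZ|h _ /imsetP[z zZ ->]].
  have zE : [set x; z] \in E by apply: sE; apply: imset_f.
  rewrite /= /edge_adj zE andbT.
  by apply: contraNneq xZ => ->.
by case/andP: (h z zZ).
Qed.

Lemma star_pairs_disjoint x y Z Z' : x \notin Z' -> y \notin Z ->
  (x = y -> [disjoint Z & Z']) ->
  [disjoint star_pairs x Z & star_pairs y Z'].
Proof.
move=> xZ' yZ dis; rewrite -setI_eq0 -subset0; apply/subsetP=> e.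
rewrite inE => /andP[/imsetP[z zZ ->] /imsetP[z' zZ' E]].
have xy : x = y.
  have : x \in [set y; z'] by rewrite -E !inE eqxx.
  by rewrite !inE => /orP[/eqP //|/eqP xz]; rewrite xz zZ' in xZ'.
have /disjointFr/(_ zZ) := dis xy.
by move: E; rewrite xy => /set2_inj->; rewrite zZ'.
Qed.

Lemma pr_universal Z (h : nat) v : v \in Z -> (h <= #|Z|)%N ->
  pr p (pairs V) (fun E => forall w, w \in Z -> ~~ nonedge (graph_of E) (v, w))
  <= p ^+ h.-1.
Proof.
move=> vZ hZ; have vZv : v \notin Z :\ v by rewrite !inE eqxx.
apply: (@le_trans _ _ (pr p (pairs V) (fun E => star_pairs v (Z :\ v) \subset E))).
  apply: pr_le => // E _ univ; apply/star_pairsP => // z; rewrite !inE => /andP[zv zZ].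
  by have := univ z zZ; rewrite /nonedge /= eq_sym zv /= negbK.
rewrite pr_subset ?star_pairs_sub // card_star_pairs.
apply: ler_wiXn2l => //; move: hZ; rewrite (cardsD1 v) vZ.
by case: h.
Qed.

Definition matched_in X M :=
  matching M && [forall e in M, inside X e && (e.1 != e.2)].

(** Failure of expansion with the sizes of [M] and [Y] prescribed exactly, so that a union bound has
    at most [n ^ (2 * s)] choices of [M] and [n ^ ((m + 2) * s)] choices of [Y]. *)
Definition not_expanding X m s E := exists M Y,
  [/\ matched_in X M, #|M| = s, #|Y| = ((m + 2) * s)%N,
      \bigcup_(e in M) ends e \subset Y &
      forall x e, x \in X -> x \notin Y -> e \in M ->
        ~~ (star_pairs x (ends e) \subset E)].

(* The events "x is joined to both ends of e", for x outside Y and e in the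
   matching M, involve disjoint sets of pairs, hence are independent. *)
Lemma pr_not_expanding X m s w : ((m + 2) * s + w <= #|X|)%N ->
  pr p (pairs V) (not_expanding X m s) <=
  (n%:R ^+ (m + 4) * (1 - p ^+ 2) ^+ w) ^+ s.
Proof.
move=> Xw; pose D := finset.setX [set M : {set V * V} | #|M| == s]
  [set Y : {set V} | #|Y| == ((m + 2) * s)%N].
pose Q (MY : {set V * V} * {set V}) E :=
  [/\ matched_in X MY.1, \bigcup_(e in MY.1) ends e \subset MY.2 &
      forall x e, x \in X -> x \notin MY.2 -> e \in MY.1 ->
        ~~ (star_pairs x (ends e) \subset E)].
apply: (@le_trans _ _ (#|D|%:R * (1 - p ^+ 2) ^+ (w * s))).
  apply: (pr_union p01 (P := Q)) => [E _ [M [Y [mM cM cY MY h]]]|[M Y]].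
    by exists (M, Y) => //; rewrite !inE cM cY !eqxx.
  rewrite !inE => /andP[/eqP cM /eqP cY].
  pose S := matched_in X M /\ \bigcup_(e in M) ends e \subset Y.
  apply: (pr_presume (S := S)) => [|E _ []//|[mM MY]].
    by apply: exprn_ge0; apply: qX_ge0.
  pose J := finset.setX (X :\: Y) M.
  pose F (xe : V * (V * V)) := star_pairs xe.1 (ends xe.2).
  have xP x e : (x, e) \in J -> [/\ x \in X, x \notin Y, e \in M & x \notin ends e].
    rewrite finset.in_setX /= => /andP[]; rewrite finset.in_setD => /andP[xY xX] eM.
    split=> //; apply: contra xY => xe.
    by apply: (subsetP MY); apply/bigcupP; exists e.
  apply: (@le_trans _ _ (pr p (pairs V)
      (fun E => forall xe, xe \in J -> ~~ (F xe \subset E)))).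
    apply: pr_le => // E _ [_ _ h] [x e] /xP[xX xY eM _]; exact: h.
  have /andP[mm /forall_inP ins] := mM.
  rewrite (pr_avoid p (k := 2)).
  (* There is one star for each element of [X :\: Y] and each pair of [M], and [X :\: Y] has at
     least [w] elements. *)
  - rewrite cardsX mulnC -cM; apply: ler_wiXn2l => //.
    rewrite mulnC leq_mul2l; apply/orP; right.
    rewrite cardsD; apply: (@leq_trans (#|X| - #|Y|)).
      by rewrite cY leq_subRL ?(leq_trans (leq_addr _ _) Xw) // mulnC.
    by apply: leq_sub2l; apply: subset_leq_card; apply: subsetIr.
  - by move=> [x e] /xP[_ _ _ xe]; apply: star_pairs_sub.
  - move=> [x e] /xP[_ _ eM _]; rewrite card_star_pairs cards2.
    by have /andP[_ ->] := ins e eM.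
  move=> [x e] [y f] xeJ yfJ xeyf.
  have [_ xY eM xe] := xP _ _ xeJ; have [_ yY fM yf] := xP _ _ yfJ.
  have nin z g : z \notin Y -> g \in M -> z \notin ends g.
    move=> zY gM; apply: contra zY => zg.
    by apply: (subsetP MY); apply/bigcupP; exists g.
  apply: star_pairs_disjoint; rewrite ?nin // => xy.
  move/forall_inP: mm => /(_ e eM)/forall_inP/(_ f fM)/implyP; apply.
  by apply: contraNneq xeyf => ->; move: xy => /= ->.
rewrite exprMn -!exprM ler_wpM2r ?exprn_ge0 //.
rewrite cardsX !card_draws card_prod -/n -natrX ler_nat.
apply: leq_trans (leq_mul (leq_bin_exp _ _) (leq_bin_exp _ _)) _.
by rewrite mulnn -expnM -expnD -mulnDl addnCA addnC.
Qed.

(** A set [Y] violating expansion may be enlarged to the exact size of [not_expanding], since a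
    larger [Y] leaves fewer vertices to test. *)
Lemma expandingP X m s E : ((m + 2) * s <= #|X|)%N ->
  (forall j, (0 < j < s)%N -> ~ not_expanding X m j E) ->
  expanding (graph_of E) X m s.
Proof.
move=> sX nex M Y mM ins Ms cY MY.
have /superset_of_card[Y' YY' cY'] : (#|Y| <= (m + 2) * #|M| <= #|V|)%N.
  rewrite cY (leq_trans _ (max_card X)) // (leq_trans _ sX) // leq_mul2l.
  by case/andP: Ms => _ /ltnW->; rewrite orbT.
apply: contrapT => nxe; apply: (nex _ Ms); exists M, Y'; split=> //.
- by apply/andP; split=> //; apply/forall_inP.
- exact: subset_trans YY'.
move=> x e xX xY' eM.
have xY : x \notin Y by apply: contra xY'; apply: (subsetP YY').
have xe : x \notin ends e.
  by apply: contra xY => xe; apply: (subsetP MY); apply/bigcupP; exists e.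
apply/(star_pairsP _ xe) => adjx; apply: nxe; exists x, e; split=> //.
by rewrite !adjx // !inE eqxx ?orbT.
Qed.

(** Union over the sizes [j] below [s]: each contributes at most [rho ^ j], which is at most [rho]
    because [j] is positive. *)
Lemma pr_expanding X m s w (rho := n%:R ^+ (m + 4) * (1 - p ^+ 2) ^+ w) :
  ((m + 2) * s + w <= #|X|)%N -> rho <= 1 ->
  pr p (pairs V) (fun E => ~ expanding (graph_of E) X m s) <= s%:R * rho.
Proof.
move=> sX rho1.
have rho0 : 0 <= rho by rewrite mulr_ge0 ?exprn_ge0 // ?ler0n ?qX_ge0.
pose D := [set j : 'I_s | (0 < j)%N].
apply: (@le_trans _ _ (#|D|%:R * rho)); last first.
  by rewrite ler_wpM2r // ler_nat (leq_trans (max_card _)) // card_ord.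
apply: (pr_union p01 (P := fun (j : 'I_s) E => not_expanding X m j E)) => [E _ nex|j].
  apply: contrapT => nj; apply: nex; apply: expandingP.
    exact: leq_trans (leq_addr _ _) sX.
  move=> j /andP[j0 js] nex; apply: nj.
  by exists (Ordinal js); rewrite // inE.
rewrite inE => j0; have jX : ((m + 2) * j + w <= #|X|)%N.
  by apply: leq_trans sX; rewrite leq_add2r leq_mul2l ltnW ?orbT.
apply: le_trans (pr_not_expanding jX) _.
rewrite -/rho -[leRHS]expr1; exact: ler_wiXn2l.
Qed.

(** * Linking the two halves through crossing pairs *)

Lemma drel_in_setU X E1 E2 e f : [disjoint pairs_in X & E2] ->
  drel_in (graph_of (E1 :|: E2)) X e f = drel_in (graph_of E1) X e f.
Proof.
move=> dis; have adjU x y : x \in X -> y \in X ->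
    adj (graph_of (E1 :|: E2)) x y = adj (graph_of E1) x y.
  move=> xX yX; rewrite /= /edge_adj; case: eqP => //= xy; rewrite inE.
  have /(disjointFr dis)-> : [set x; y] \in pairs_in X; last by rewrite orbF.
  rewrite inE cards2; apply/andP; split; last by move/eqP: xy => ->.
  by apply/subsetP=> z; rewrite !inE => /orP[]/eqP->.
rewrite /drel_in; case: (boolP (inside X e && inside X f)); last first.
  by rewrite !andbF.
case/andP=> /andP[e1 e2] /andP[f1 f2].
by rewrite /drel /nonedge /joined !adjU.
Qed.

Definition has_matching X s E (e : V * V) := exists M,
  [/\ matching M, forall g, g \in M -> connect (drel_in (graph_of E) X) e g
    & (s <= #|M|)%N].

Lemma has_matching_exact X s E e : has_matching X s E e -> exists M,
  [/\ matching M, forall g, g \in M -> connect (drel_in (graph_of E) X) e g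
    & #|M| = s].
Proof.
case=> M [mM cM /subset_of_card[M' MM' cM']]; exists M'; split=> //.
  apply/forall_inP=> f /(subsetP MM') fM; apply/forall_inP=> g /(subsetP MM') gM.
  by move/forall_inP: mM => /(_ f fM)/forall_inP; apply.
by move=> g /(subsetP MM'); apply: cM.
Qed.

Definition cross_pairs (e f : V * V) : {set {set V}} :=
  [set [set x; y] | x in ends e, y in ends f].

Lemma set2_cross X x y a b : x \in X -> a \in X -> y \notin X -> b \notin X ->
  [set x; y] = [set a; b] -> x = a /\ y = b.
Proof.
move=> xX aX yX bX E.
have : x \in [set a; b] by rewrite -E !inE eqxx.
rewrite !inE => /orP[/eqP xa|/eqP xb]; last by rewrite xb (negbTE bX) in xX.
by split=> //; move: E; rewrite xa => /set2_inj.
Qed.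

Lemma cross_pairsP X E e f : inside X e -> inside (~: X) f ->
  cross_pairs e f \subset E -> joined (graph_of E) e f.
Proof.
move=> /andP[e1 e2] /andP[]; rewrite !inE => f1 f2 /subsetP sE.
have h x y : x \in ends e -> y \in ends f -> x \in X -> y \notin X ->
    adj (graph_of E) x y.
  move=> xe yf xX yX; apply/andP; split; first by apply: contraNneq yX => <-.
  by apply: sE; apply/imset2P; exists x y.
by apply/and4P; split; apply: h; rewrite // !inE eqxx ?orbT.
Qed.

Lemma card_cross_pairs X e f : inside X e -> inside (~: X) f ->
  e.1 != e.2 -> f.1 != f.2 -> #|cross_pairs e f| = 4.
Proof.
move=> /andP[e1 e2] /andP[]; rewrite !inE => f1 f2 ne nf.
have -> : cross_pairs e f = [set [set xy.1; xy.2] | xy in finset.setX (ends e) (ends f)].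
  apply/setP=> g; apply/imset2P/imsetP => [[x y xe yf ->]|[[x y]]].
    by exists (x, y); rewrite // finset.in_setX xe yf.
  by rewrite finset.in_setX => /andP[xe yf] ->; exists x y.
rewrite card_in_imset.
  by rewrite cardsX !cards2 ne nf.
have inX x : x \in ends e -> x \in X by rewrite !inE => /orP[]/eqP->.
have ninX x : x \in ends f -> x \notin X by rewrite !inE => /orP[]/eqP->.
move=> [x y] [a b]; rewrite !finset.in_setX /= => /andP[/inX xe /ninX yf].
by move=> /andP[/inX ae /ninX bf] /(set2_cross xe ae yf bf)[-> ->].
Qed.

(** A crossing pair determines its end in [X] and its end outside, and these determine the members
    of the two matchings that contain them. *)
Lemma cross_pairs_disjoint X M M' e f g h :
  matching M -> matching M' -> inside X e -> inside (~: X) f ->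
  inside X g -> inside (~: X) h -> e \in M -> g \in M -> f \in M' -> h \in M' ->
  (e, f) != (g, h) -> [disjoint cross_pairs e f & cross_pairs g h].
Proof.
move=> mM mM' ie ifx ig ih eM gM fM hM ne.
have inX k x : inside X k -> x \in ends k -> x \in X.
  by case/andP=> k1 k2; rewrite !inE => /orP[]/eqP->.
have ninX k x : inside (~: X) k -> x \in ends k -> x \notin X.
  by case/andP; rewrite !inE => k1 k2 /orP[]/eqP->.
rewrite -setI_eq0 -subset0; apply/subsetP=> c; rewrite inE.
case/andP=> /imset2P[x y xe yf ->] /imset2P[a b ag bh].
move/(set2_cross (inX _ _ ie xe) (inX _ _ ig ag) (ninX _ _ ifx yf) (ninX _ _ ih bh)).
case=> xa yb; subst a b.
case/boolP: (e == g) => [/eqP eg|eg].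
  have fh : f != h by apply: contraNneq ne => ->; rewrite eg.
  move/forall_inP: mM' => /(_ f fM)/forall_inP/(_ h hM)/implyP/(_ fh).
  by move/disjointFr/(_ yf); rewrite bh.
move/forall_inP: mM => /(_ e eM)/forall_inP/(_ g gM)/implyP/(_ eg).
by move/disjointFr/(_ xe); rewrite ag.
Qed.

(* The matchings depend only on the pairs inside [X] and inside its
   complement, and are fixed before the crossing pairs are exposed. *)
Lemma pr_not_connected X s e f :
  pr p (pairs V) (fun E =>
    [/\ [/\ nonedge (graph_of E) e, inside X e & has_matching X s E e],
        [/\ nonedge (graph_of E) f, inside (~: X) f & has_matching (~: X) s E f]
      & ~ connect (drel (graph_of E)) e f]) <= (1 - p ^+ 4) ^+ (s * s).
Proof.
pose B1 := pairs_in X :|: pairs_in (~: X).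
have B1p : B1 \subset pairs V by rewrite subUset !pairs_in_sub.
rewrite -(setUDK B1p); apply: pr_cond => [||E1 s1]; rewrite ?disjointDr //.
have c0 : 0 <= (1 - p ^+ 4) ^+ (s * s) by rewrite exprn_ge0.
have disX Z E2 : Z \in [:: X; ~: X] -> E2 \subset pairs V :\: B1 ->
    [disjoint pairs_in Z & E2].
  move=> ZX s2; apply: disjointWr s2 _.
  have : pairs_in Z \subset B1.
    by move: ZX; rewrite !inE => /orP[]/eqP->; [apply: subsetUl | apply: subsetUr].
  by move/disjointWl; apply; apply: disjointDr.
have XX : X \in [:: X; ~: X] by rewrite !inE eqxx.
have cXX : ~: X \in [:: X; ~: X] by rewrite !inE eqxx orbT.
have hmU Z E2 g : Z \in [:: X; ~: X] -> E2 \subset pairs V :\: B1 ->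
    has_matching Z s (E1 :|: E2) g -> has_matching Z s E1 g.
  move=> ZX s2 [M [mM cM sM]]; exists M; split=> // k /cM.
  by rewrite (eq_connect (fun _ _ => drel_in_setU _ _ _ (disX Z E2 ZX s2))).
(* Exposing more pairs only adds edges, so pairs non-adjacent at the end are already non-adjacent in
   [E1]. *)
have neU E2 g : nonedge (graph_of (E1 :|: E2)) g -> nonedge (graph_of E1) g.
  case/andP=> g12; rewrite /nonedge /= /edge_adj g12 inE /=.
  by rewrite negb_or => /andP[].
pose S := [/\ inside X e /\ inside (~: X) f, nonedge (graph_of E1) e,
  nonedge (graph_of E1) f, has_matching X s E1 e & has_matching (~: X) s E1 f].
apply: (pr_presume (S := S)) => // [E2 s2|].
  case=> [[ne ie hM] [nf jf hM'] _]; split=> //;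
    [exact: neU ne | exact: neU nf | exact: hmU hM | exact: hmU hM'].
case=> [[ie jf] ne nf /has_matching_exact[M [mM cM sM]]].
case/has_matching_exact=> M' [mM' cM' sM'].
have MP g : g \in M -> nonedge (graph_of E1) g && inside X g.
  by move=> /cM; apply: connect_drel_in_nonedge.
have MP' g : g \in M' -> nonedge (graph_of E1) g && inside (~: X) g.
  by move=> /cM'; apply: connect_drel_in_nonedge.
pose J := finset.setX M M'.
pose F (gh : (V * V) * (V * V)) := cross_pairs gh.1 gh.2.
apply: (@le_trans _ _ (pr p (pairs V :\: B1)
    (fun E => forall gh, gh \in J -> ~~ (F gh \subset E)))).
  apply: pr_le => // E2 s2 [[ne2 _ _] [nf2 _ _] nc] [g h].
  rewrite finset.in_setX /= => /andP[gM hM]; apply/negP=> /= sF; apply: nc.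
  have /andP[_ ig] := MP g gM; have /andP[_ ih] := MP' h hM.
  have cg : connect (drel_in (graph_of (E1 :|: E2)) X) e g.
    by rewrite (eq_connect (fun _ _ => drel_in_setU _ _ _ (disX X E2 XX s2))) cM.
  have ch : connect (drel_in (graph_of (E1 :|: E2)) (~: X)) f h.
    by rewrite (eq_connect (fun _ _ => drel_in_setU _ _ _ (disX _ E2 cXX s2))) cM'.
  have /andP[ng _] := connect_drel_in_nonedge ne2 ie cg.
  have /andP[nh _] := connect_drel_in_nonedge nf2 jf ch.
  have gh : drel (graph_of (E1 :|: E2)) g h.
    rewrite /drel ng nh; apply: (cross_pairsP ig ih).
    exact: subset_trans sF (subsetUr _ _).
  apply: connect_trans (connect_drel_in cg) _.
  apply: connect_trans (connect1 gh) _.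
  rewrite (sym_connect_sym (@drel_sym _ _)); exact: connect_drel_in ch.
(* Each of the [s * s] possible links needs four crossing pairs, and different links need disjoint
   ones. *)
rewrite (pr_avoid p (k := 4)).
- by rewrite cardsX sM sM'.
- move=> [g h]; rewrite finset.in_setX /= => /andP[/MP/andP[ng ig] /MP'/andP[nh ih]].
  apply/subsetP=> _ /imset2P[x y xg yh ->].
  have xX : x \in X by case/andP: ig => g1 g2; move: xg; rewrite !inE => /orP[]/eqP->.
  have yX : y \notin X.
    by case/andP: ih; rewrite !inE => g1 g2; move: yh; rewrite !inE => /orP[]/eqP->.
  rewrite finset.in_setD set2_pairs ?andbT; last by apply: contraNneq yX => <-.
  rewrite !inE negb_or !negb_and; apply/andP; split; apply/orP; left.
    by apply: contra yX => /subsetP; apply; rewrite !inE eqxx orbT.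
  by apply/negP=> /subsetP/(_ x); rewrite !inE eqxx xX => /(_ isT).
- move=> [g h]; rewrite finset.in_setX /= => /andP[/MP/andP[ng ig] /MP'/andP[nh ih]].
  by case/andP: ng; case/andP: nh => *; apply: card_cross_pairs ig ih _ _.
move=> [g h] [g' h']; rewrite !finset.in_setX /= => /andP[gM hM] /andP[gM' hM'] ne'.
have /andP[_ ig] := MP g gM; have /andP[_ ih] := MP' h hM.
have /andP[_ ig'] := MP g' gM'; have /andP[_ ih'] := MP' h' hM'.
exact: (@cross_pairs_disjoint X M M').
Qed.

(** If CFS fails, then a half does not expand, or there is a clique on [m] vertices, or two
    non-adjacent pairs in different halves are not connected despite large matchings, or some vertex
    is joined to all the rest of its half. The four summands bound these events in this order. *)
Lemma pr_not_CFS_dense X h m s w (rho := n%:R ^+ (m + 4) * (1 - p ^+ 2) ^+ w) :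
  (0 < m)%N -> (0 < h)%N -> (h <= #|X|)%N -> (h <= #|~: X|)%N ->
  ((m + 2) * s + w <= h)%N -> rho <= 1 ->
  pr p (pairs V) (fun E => ~ CFS (graph_of E)) <=
  (s%:R * rho) *+ 2 + n%:R ^+ m * p ^+ 'C(m, 2) +
  n%:R ^+ 4 * (1 - p ^+ 4) ^+ (s * s) + n%:R * p ^+ h.-1.
Proof.
move=> m0 h0 hX hcX swh rho1.
pose NE Z E := ~ expanding (graph_of E) Z m s.
pose NC E := ~ clique_free (graph_of E) [set: V] m.
pose NJ E := exists2 ef : (V * V) * (V * V), ef \in [set: _] &
  [/\ [/\ nonedge (graph_of E) ef.1, inside X ef.1 & has_matching X s E ef.1],
      [/\ nonedge (graph_of E) ef.2, inside (~: X) ef.2 & has_matching (~: X) s E ef.2]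
    & ~ connect (drel (graph_of E)) ef.1 ef.2].
pose half v := if v \in X then X else ~: X.
pose NU E := exists2 v, v \in [set: V] &
  forall w, w \in half v -> ~~ nonedge (graph_of E) (v, w).
apply: (le_trans (pr_or p01 (P2 := NU)
  (P1 := fun E => ((NE X E \/ NE (~: X) E) \/ NC E) \/ NJ E) _)); last first.
  apply: lerD; last first.
    apply: (@le_trans _ _ (#|[set: V]|%:R * p ^+ h.-1)); last by rewrite cardsT.
    apply: (pr_union p01 (P := fun v E => forall w, w \in half v ->
      ~~ nonedge (graph_of E) (v, w))) => // v _.
    rewrite /half; case: ifPn => vX; first exact: pr_universal.
    by apply: pr_universal; rewrite // inE.
  apply: (le_trans (pr_or p01 (P1 := fun E => (NE X E \/ NE (~: X) E) \/ NC E)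
    (P2 := NJ) _)) => //; apply: lerD; last first.
    pose D := [set: (V * V) * (V * V)].
    apply: (@le_trans _ _ (#|D|%:R * (1 - p ^+ 4) ^+ (s * s))); last first.
      rewrite cardsT !card_prod !natrM -/n ler_wpM2r ?exprn_ge0 //.
      by rewrite !exprS expr0 mulr1 !mulrA.
    apply: (pr_union p01 (P := fun ef E => [/\ [/\ nonedge (graph_of E) ef.1,
      inside X ef.1 & has_matching X s E ef.1],
      [/\ nonedge (graph_of E) ef.2, inside (~: X) ef.2 & has_matching (~: X) s E ef.2]
    & ~ connect (drel (graph_of E)) ef.1 ef.2])) => // ef _.
    exact: pr_not_connected.
  apply: (le_trans (pr_or p01 (P1 := fun E => NE X E \/ NE (~: X) E)
    (P2 := NC) _)) => //; apply: lerD; last exact: pr_clique.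
  apply: (le_trans (pr_or p01 (P1 := NE X) (P2 := NE (~: X)) _)) => //.
  by rewrite mulr2n; apply: lerD; apply: pr_expanding => //; apply: leq_trans hcX || apply: leq_trans hX.
move=> E sE nCFS; apply: contrapT => /not_orP[/not_orP[/not_orP[/not_orP[]]]].
move=> /contrapT eX /contrapT ecX /contrapT cf nNJ nNU; apply: nCFS.
apply: (@CFS_of_halves _ _ X).
- by rewrite -card_gt0 (leq_trans h0).
- by rewrite -card_gt0 (leq_trans h0).
- move=> Z v ZX vZ; apply: contrapT => nw; apply: nNU; exists v => // u uv.
  have hv : half v = Z.
    rewrite /half; move: ZX vZ; rewrite !inE => /orP[]/eqP->; first by move->.
    by rewrite inE => /negbTE->.
  by apply/negP=> nvu; apply: nw; exists u; rewrite // -hv.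
move=> e f ne ie nf jf; apply: contrapT => nc; apply: nNJ; exists (e, f) => //=.
split=> //; split=> //.
  exact: large_matching m0 eX (clique_freeS cf) ne ie.
exact: large_matching m0 ecX (clique_freeS cf) nf jf.
Qed.

(** * Graphs with few missing edges, then sparse graphs *)

Lemma nonedge_or_clique E X :
  (exists e, nonedge (graph_of E) e && inside X e) \/ pairs_in X \subset E.
Proof.
case: (pselect (exists e, nonedge (graph_of E) e && inside X e)).
  by left.
move=> ne; right; apply: pairs_in_clique => // x y xX yX xy.
apply: contrapT => /negP nxy; apply: ne; exists (x, y).
by rewrite /nonedge /inside /= xX yX xy nxy.
Qed.

Lemma pr_no_nonedge X h : (h <= #|X|)%N ->
  pr p (pairs V) (fun E => pairs_in X \subset E) <= p ^+ 'C(h, 2).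
Proof.
move=> hX; rewrite pr_subset ?pairs_in_sub // card_pairs_in.
by apply: ler_wiXn2l; rewrite // leq_bin2l.
Qed.

Definition common_nbrs Z E : {set V} :=
  [set x in ~: Z | star_pairs x Z \subset E].

(** With fewer than [h] common neighbours, at least [y] vertices outside [Z] miss some vertex of
    [Z]. The union bound runs over the at most [2 ^ n] sets of such vertices, whose stars are
    disjoint. *)
Lemma pr_few_common_nbrs Z h y : (#|Z| <= 4)%N -> (y + h + 4 <= n)%N ->
  pr p (pairs V) (fun E => (#|common_nbrs Z E| < h)%N) <=
  2 ^+ n * (1 - p ^+ 4) ^+ y.
Proof.
move=> Z4 yh; pose D := [set Y : {set V} | (Y \subset ~: Z) && (y <= #|Y|)%N].
pose Q (Y : {set V}) E := forall x, x \in Y -> ~~ (star_pairs x Z \subset E).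
apply: (@le_trans _ _ (#|D|%:R * (1 - p ^+ 4) ^+ y)); last first.
  rewrite ler_wpM2r ?exprn_ge0 // -natrX ler_nat.
  apply: leq_trans (max_card _) _.
  by rewrite -cardsT -powersetT card_powerset cardsT.
apply: (pr_union p01 (P := Q)) => [E _ Nh|Y].
  exists (~: Z :\: common_nbrs Z E).
    rewrite inE subsetDl /=.
    have sN : common_nbrs Z E \subset ~: Z.
      by apply/subsetP=> x; rewrite inE => /andP[].
    rewrite cardsD (setIidPr sN) cardsCs setCK -/n leq_subRL; last first.
      by move: (subset_leq_card sN); rewrite [X in (_ <= X)%N]cardsCs setCK.
    rewrite leq_subRL; last exact: max_card.
    apply: leq_trans yh; rewrite addnC; apply: leq_add => //.
    by rewrite addnC leq_add2l ltnW.
  move=> x; rewrite finset.in_setD => /andP[+ xZ].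
  by rewrite inE xZ.
rewrite inE => /andP[YZ yY]; rewrite /Q (pr_avoid p (k := #|Z|)).
- apply: (@le_trans _ _ ((1 - p ^+ 4) ^+ #|Y|)); last exact: ler_wiXn2l.
  by rewrite lerXn2r ?nnegrE // lerD2l lerN2 ler_wiXn2l.
- by move=> x /(subsetP YZ); rewrite inE => xZ; apply: star_pairs_sub.
- by move=> x _; rewrite card_star_pairs.
move=> x x' /(subsetP YZ) + /(subsetP YZ); rewrite !inE => xZ x'Z xx'.
by apply: star_pairs_disjoint => // E; rewrite E eqxx in xx'.
Qed.

(* Given the pairs meeting [Z], which determine the common neighbours of [Z],
   the pairs inside the set of common neighbours are still independent. *)
Lemma pr_clique_common_nbrs Z h :
  pr p (pairs V) (fun E => (h <= #|common_nbrs Z E|)%N /\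
    pairs_in (common_nbrs Z E) \subset E) <= p ^+ 'C(h, 2).
Proof.
have sB := pairs_in_sub (~: Z).
rewrite -(setUDK sB) setUC; apply: pr_cond => [||E1 s1] //.
  by rewrite disjoint_sym disjointDr.
have NU E2 : E2 \subset pairs_in (~: Z) ->
    common_nbrs Z (E1 :|: E2) = common_nbrs Z E1.
  move=> s2; apply/setP=> x; rewrite !inE; case xZ: (x \in Z) => //=.
  rewrite (@subset_disjointU _ _ _ _ (pairs_in (~: Z))) //.
  rewrite -setI_eq0 -subset0; apply/subsetP=> e; rewrite inE.
  case/andP=> /imsetP[z zZ ->]; rewrite inE => /andP[/subsetP/(_ z)].
  by rewrite !inE eqxx orbT zZ => /(_ isT).
apply: (pr_presume (S := (h <= #|common_nbrs Z E1|)%N)) => // [E2 s2|hN].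
  by rewrite NU // => -[].
have sN : pairs_in (common_nbrs Z E1) \subset pairs_in (~: Z).
  apply/subsetP=> e; rewrite !inE => /andP[sN ->]; rewrite andbT.
  by apply: subset_trans sN _; apply/subsetP=> x; rewrite inE => /andP[].
apply: (@le_trans _ _ (pr p (pairs_in (~: Z))
    (fun E => pairs_in (common_nbrs Z E1) \subset E))).
  apply: pr_le => // E2 s2 [_]; rewrite NU // setUC.
  rewrite (@subset_disjointU _ _ _ _ (pairs V :\: pairs_in (~: Z))) //.
  apply: disjointWl sN _; exact: disjointDr.
by rewrite pr_subset // card_pairs_in; apply: ler_wiXn2l; rewrite // leq_bin2l.
Qed.

(** For each of the [n ^ 4] choices of two pairs, the common neighbours of their at most four ends
    are too few, or form a clique, or contain a pair related to both. The final term excludes the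
    complete graph, which has no diagonal to start from. *)
Lemma pr_not_CFS_codense h y : (y + h + 4 <= n)%N ->
  pr p (pairs V) (fun E => ~ CFS (graph_of E)) <=
  n%:R ^+ 4 * (2 ^+ n * (1 - p ^+ 4) ^+ y + p ^+ 'C(h, 2)) + p ^+ 'C(h, 2).
Proof.
move=> yh.
pose Z (ef : (V * V) * (V * V)) := ends ef.1 :|: ends ef.2.
pose Q ef E := (#|common_nbrs (Z ef) E| < h)%N \/
  ((h <= #|common_nbrs (Z ef) E|)%N /\
    pairs_in (common_nbrs (Z ef) E) \subset E).
have qn : (h <= #|[set: V]|)%N.
  by rewrite cardsT; apply: leq_trans yh; rewrite addnAC leq_addl.
apply: (le_trans (pr_or p01 (P1 := fun E => exists2 ef, ef \in [set: _] & Q ef E)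
  (P2 := fun E => pairs_in [set: V] \subset E) _)); last first.
  apply: lerD (pr_no_nonedge qn); pose D := [set: (V * V) * (V * V)].
  apply: (@le_trans _ _ (#|D|%:R * (2 ^+ n * (1 - p ^+ 4) ^+ y + p ^+ 'C(h, 2)))); last first.
    rewrite cardsT !card_prod !natrM -/n ler_wpM2r //; last first.
      by rewrite !exprS expr0 mulr1 !mulrA.
    by rewrite addr_ge0 ?mulr_ge0 ?exprn_ge0 ?ler0n.
  apply: (pr_union p01 (P := Q)) => // ef _.
  apply: (le_trans (pr_or p01
    (P1 := fun E => (#|common_nbrs (Z ef) E| < h)%N)
    (P2 := fun E => (h <= #|common_nbrs (Z ef) E|)%N /\
      pairs_in (common_nbrs (Z ef) E) \subset E) _)) => //.
  apply: lerD (pr_clique_common_nbrs _ _); apply: pr_few_common_nbrs => //.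
  apply: leq_trans (leq_card_setU _ _) _; apply: (@leq_trans (2 + 2)) => //.
  by apply: leq_add; rewrite cards2; case: eqP.
move=> E sE nCFS; have [[e0 /andP[ne0 _]]|] := nonedge_or_clique E [set: V]; last by right.
left; apply: contrapT => nQ; apply: nCFS; apply: (CFS_of_common_joined ne0) => e f ne nf.
apply: contrapT => ng; apply: nQ; exists (e, f) => //; rewrite /Q.
case: ltnP => [|hN]; [by left | right; split=> //].
have [[g /andP[nng ig]]|//] := nonedge_or_clique E (common_nbrs (Z (e, f)) E).
case: ng; exists g; move: ig => /andP[]; rewrite !inE.
move=> /andP[g1 s1] /andP[g2 s2]; rewrite /drel ne nf nng /=.
have jn k : k \in [:: e; f] -> joined (graph_of E) k g.
  move=> kef; have sub : ends k \subset Z (e, f).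
    by move: kef; rewrite !inE => /orP[]/eqP->; [apply: subsetUl | apply: subsetUr].
  have adjk z : z \in ends k -> adj (graph_of E) z g.1 && adj (graph_of E) z g.2.
    move=> /(subsetP sub) zZ; rewrite !(adj_sym _ z); apply/andP; split.
      by move/star_pairsP: s1; apply; rewrite // !inE.
    by move/star_pairsP: s2; apply; rewrite // !inE.
  have /andP[a b] : adj (graph_of E) k.1 g.1 && adj (graph_of E) k.1 g.2.
    by apply: adjk; rewrite !inE eqxx.
  have /andP[c d] : adj (graph_of E) k.2 g.1 && adj (graph_of E) k.2 g.2.
    by apply: adjk; rewrite !inE eqxx orbT.
  exact/and4P.
by rewrite !jn // !inE eqxx ?orbT.
Qed.

(** The cubic term excludes vertices with two non-neighbours. The other two exclude complete halves,
    so that a missing edge in each half gives two disjoint ones. *)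
Lemma pr_not_CFS_comatching X h : (h <= #|X|)%N -> (h <= #|~: X|)%N ->
  pr p (pairs V) (fun E => ~ CFS (graph_of E)) <=
  n%:R ^+ 3 * (1 - p) ^+ 2 + p ^+ 'C(h, 2) *+ 2.
Proof.
move=> hX hcX.
pose Q (t : V * V * V) E :=
  [/\ t.1.1 != t.1.2, t.1.1 != t.2, t.1.2 != t.2 &
     [disjoint star_pairs t.1.1 [set t.1.2; t.2] & E]].
have q0 : 0 <= 1 - p by rewrite subr_ge0.
apply: (le_trans (pr_or p01 (P1 := fun E => exists2 t, t \in [set: _] & Q t E)
  (P2 := fun E => pairs_in X \subset E \/ pairs_in (~: X) \subset E) _)); last first.
  apply: lerD; last first.
    apply: (le_trans (pr_or p01 (P1 := fun E => pairs_in X \subset E)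
      (P2 := fun E => pairs_in (~: X) \subset E) _)) => //.
    by rewrite mulr2n; apply: lerD; apply: pr_no_nonedge.
  pose D := [set: V * V * V].
  apply: (@le_trans _ _ (#|D|%:R * (1 - p) ^+ 2)); last first.
    rewrite cardsT !card_prod !natrM -/n ler_wpM2r ?exprn_ge0 //.
    by rewrite !exprS expr0 mulr1 !mulrA.
  apply: (pr_union p01 (P := Q)) => // -[[x y] z] _.
  apply: (pr_presume (S := [/\ x != y, x != z & y != z])) => //=.
  - exact: exprn_ge0.
  - by move=> E _ [].
  case=> xy xz yz; have xyz : x \notin [set y; z] by rewrite !inE negb_or xy.
  apply: (@le_trans _ _ (pr p (pairs V)
    (fun E => [disjoint star_pairs x [set y; z] & E]))).
    by apply: pr_le => // E _ [].
  by rewrite pr_disjoint ?star_pairs_sub // card_star_pairs cards2 yz.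
move=> E sE nCFS.
have [[e0 /andP[ne0 ie0]]|] := nonedge_or_clique E X; last by right; left.
have [[e1 /andP[ne1 ie1]]|] := nonedge_or_clique E (~: X); last by right; right.
have nin x : x \in X -> x \notin ends e1.
  move=> xX; case/andP: ie1; rewrite !inE => h1 h2; rewrite negb_or.
  by apply/andP; split; apply: contraTneq xX => ->.
case/andP: ie0 => /nin h1 /nin h2.
left; apply: contrapT => nQ; apply: nCFS.
apply: (CFS_of_disjoint_nonedges ne0 ne1 h1 h2) => x y z yz nxy.
apply: contrapT => /negP; rewrite negb_or => /andP[nxz xz]; apply: nQ.
exists (x, y, z) => //; case/andP: nxy => /= xy nxy; split=> //=.
rewrite -setI_eq0 -subset0; apply/subsetP=> e; rewrite inE.
case/andP=> /imsetP[u]; rewrite !inE => /orP[]/eqP-> -> eE.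
  by move: nxy; rewrite /edge_adj xy eE.
by move: nxz; rewrite /= /edge_adj xz eE.
Qed.

(** First moment over the sets of [4 + k] vertices and, in each, over the sets of [2 * k] pairs, at
    most [2 ^ 'C(4 + k, 2)] in number. *)
Lemma pr_CFS_sparse k : (4 + k <= n)%N ->
  pr p (pairs V) (fun E => CFS (graph_of E)) <=
  n%:R ^+ (4 + k) * (2 ^+ 'C(4 + k, 2) * p ^+ (2 * k)).
Proof.
move=> kn; pose D := [set S : {set V} | #|S| == 4 + k]%N.
have c0 : 0 <= 2 ^+ 'C(4 + k, 2) * p ^+ (2 * k) :> R.
  by rewrite mulr_ge0 ?exprn_ge0 ?ler0n.
apply: (@le_trans _ _ (#|D|%:R * (2 ^+ 'C(4 + k, 2) * p ^+ (2 * k)))); last first.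
  by rewrite ler_wpM2r // -natrX ler_nat card_draws leq_bin_exp.
pose DF (S : {set V}) := [set F : {set {set V}} | (F \subset pairs_in S) && (#|F| == 2 * k)%N].
pose Q S E := exists2 F, F \in DF S & F \subset E.
apply: (pr_union p01 (P := Q)) => [E sE cfs|S].
  have [S cS /subset_of_card[F FS cF]] := CFS_dense_subset cfs kn.
  exists S; first by rewrite inE cS.
  exists F; last by apply: subset_trans FS _; apply/subsetP=> e; rewrite inE => /andP[].
  rewrite inE cF eqxx andbT; apply: subset_trans FS _; apply/subsetP=> e.
  by rewrite !inE => /andP[/(subsetP sE) + ->]; rewrite inE.
rewrite inE => /eqP cS.
apply: (@le_trans _ _ (#|DF S|%:R * p ^+ (2 * k))); last first.
  rewrite ler_wpM2r // -natrX ler_nat -cS -card_pairs_in -card_powerset.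
  by apply: subset_leq_card; apply/subsetP=> F; rewrite !inE => /andP[].
apply: (pr_union p01 (P := fun (F : {set {set V}}) E => F \subset E)) => // F.
rewrite inE => /andP[FS /eqP cF].
by rewrite pr_subset ?cF // (subset_trans FS) ?pairs_in_sub.
Qed.

End RandomGraph.

(* Imported only here: these libraries shadow the notations of finset. *)
From mathcomp Require Import all_classical all_reals all_analysis.
Import numFieldNormedType.Exports.

Local Open Scope classical_set_scope.

(** * Asymptotics *)

Section Estimates.
Variable R : realType.
Implicit Types (x p c l t a : R).

Lemma expr1B_le_expR a k : 0 <= a <= 1 -> (1 - a) ^+ k <= expR (- (a * k%:R)).
Proof.
case/andP=> a0 a1; rewrite -mulNr expRM_natr lerXn2r ?nnegrE ?subr_ge0 ?expR_ge0 //.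
exact: expR_ge1Dx.
Qed.

Lemma expr_expR_ln x k : 0 < x -> x ^+ k = expR (ln x * k%:R).
Proof. by move=> x0; rewrite expRM_natr lnK. Qed.

Lemma ln_le_powR x a : 0 < x -> 0 < a -> ln x <= a^-1 * x `^ a.
Proof.
move=> x0 a0; rewrite -(ler_pM2l a0) mulrA divff ?gt_eqF // mul1r -ln_powR.
have y0 := powR_gt0 a x0; rewrite -ler_expR lnK ?posrE //.
by apply: le_trans (expR_ge1Dx _); rewrite lerDr.
Qed.

Lemma natr_bin2 m : 'C(m, 2)%:R = m%:R * (m%:R - 1) / 2 :> R.
Proof.
have E : 'C(m, 2)%:R * 2 = m%:R * (m%:R - 1) :> R.
  case: m => [|m]; first by rewrite bin0n !mul0r.
  have := bin_ffact m.+1 2; rewrite ffactnSr ffactn1 subn1 /= => E.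
  by rewrite -[in m.+1%:R - 1]natr1 addrK -[RHS]natrM -E natrM.
by rewrite -E mulfK.
Qed.

Lemma half_ge n : n%:R / 2 - 1 <= (n./2)%:R :> R.
Proof.
have : n%:R = (odd n + n./2.*2)%:R :> R by rewrite odd_double_half.
rewrite natrD -muln2 natrM; have : (odd n)%:R <= 1 :> R by case: (odd n).
by move=> ? ->; lra.
Qed.

Lemma divn_ge n d : (0 < d)%N -> n%:R / d%:R - 1 <= (n %/ d)%:R :> R.
Proof.
move=> d0; have d0R : 0 < d%:R :> R by rewrite ltr0n.
rewrite lerBlDr natr1 ler_pdivrMr // -natrM ler_nat ltnW //.
exact: ltn_ceil.
Qed.

Lemma divn_le n d : (0 < d)%N -> (n %/ d)%:R <= n%:R / d%:R :> R.
Proof.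
move=> d0; have d0R : 0 < d%:R :> R by rewrite ltr0n.
by rewrite ler_pdivlMr // -natrM ler_nat leq_trunc_div.
Qed.

(** * Exponents in the regime [p <= 99 / 100] *)

Lemma dense_sqr_ge (c l : R) : 0 <= c -> 40 * 40 * (4 * c + 1) <= l ->
  [/\ 40 * 40 <= l, 0 <= c * l, 40 * 40 * (4 * (c * l) + l) <= l ^+ 2
    & 40 * 40 <= l ^+ 2].
Proof.
move=> c0 bl; have lg : 40 * 40 <= l by move: c0 bl; clear; lra.
have l0 : 0 <= l by move: lg; clear; lra.
have cl0 : 0 <= c * l by exact: mulr_ge0.
(* One factor [l] absorbs [4 * c + 1] and the constants; [40 * 40] is what the square of
   [l ^ 2 / 40] in the linking exponent requires. *)
have H : 40 * 40 * (4 * (c * l) + l) <= l ^+ 2.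
  have -> : 40 * 40 * (4 * (c * l) + l) = 40 * 40 * (4 * c + 1) * l by ring.
  by rewrite expr2 ler_wpM2r.
by split=> //; move: H cl0 lg; clear; lra.
Qed.

Lemma dense_quartic_ge (c l : R) : 0 <= c -> 40 * 40 * (4 * c + 1) <= l ->
  40 * 40 * (4 * (c * l) * l ^+ 2 + l * l ^+ 2) <= l ^+ 4 /\
  40 * 40 * (4 * (c * l) + l) <= l ^+ 4.
Proof.
move=> c0 bl; have [lg cl0 H l2g] := dense_sqr_ge c0 bl.
have l21 : 1 <= l ^+ 2 by move: l2g; clear; lra.
have l20 : 0 <= l ^+ 2 by move: l2g; clear; lra.
have E : l ^+ 4 = l ^+ 2 * l ^+ 2 by rewrite -exprD.
split.
  have -> : 40 * 40 * (4 * (c * l) * l ^+ 2 + l * l ^+ 2) =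
    40 * 40 * (4 * (c * l) + l) * l ^+ 2 by ring.
  by rewrite E ler_wpM2r.
apply: le_trans H _; rewrite E; exact: ler_peMl.
Qed.

(** Exponent of [n ^ (m + 5) * (1 - p ^ 2) ^ w], with [y] for [ln n], [x] for [n] and [P] for
    [p ^ 2]: the gain [P * W] is at least [l ^ 4 / 16], against a cost of order [c * l ^ 3]. *)
Lemma dense_expansion_exponent (c l y x P M W : R) : 0 <= c -> 40 * 40 * (4 * c + 1) <= l ->
  0 <= y <= c * l -> 0 <= M <= l ^+ 2 + 1 -> 0 <= P -> l ^+ 4 <= x * P ->
  x / 16 <= W -> y * (M + 5) - P * W <= - l.
Proof.
move=> c0 bl /andP[y0 ycl] /andP[M0 M1] P0 lP xW.
have [lg cl0 _ _] := dense_sqr_ge c0 bl.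
have l0 : 0 <= l by move: lg; clear; lra.
have A1 : y * (M + 5) <= c * l * (l ^+ 2 + 6).
  by apply: ler_pM => //; move: M0 M1; clear; lra.
have A2 : c * l * (l ^+ 2 + 6) = c * l * l ^+ 2 + 6 * (c * l) by ring.
have A3 : P * (x / 16) <= P * W by rewrite ler_wpM2l.
have A4 : P * (x / 16) = x * P / 16 by ring.
have [] := dense_quartic_ge c0 bl.
have : 0 <= c * l * l ^+ 2 by rewrite mulr_ge0 ?sqr_ge0.
have : 0 <= l * l ^+ 2 by rewrite mulr_ge0 ?sqr_ge0.
move: cl0 l0 A1 A2 A3 A4 lP; clear; lra.
Qed.

(** Exponent of [n ^ m * p ^ 'C(m, 2)], up to sign: as [m] is at least [l ^ 2], its square outweighs
    [m * ln n]. *)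
Lemma dense_clique_exponent (c l y M : R) : 0 <= c -> 40 * 40 * (4 * c + 1) <= l ->
  y <= c * l -> l ^+ 2 <= M -> l <= M * ((M - 1) / 200 - y).
Proof.
move=> c0 bl ycl lM; have [lg cl0 H l2g] := dense_sqr_ge c0 bl.
have B : l <= (M - 1) / 200 - y by move: H cl0 lg ycl lM; clear; lra.
apply: le_trans B _; rewrite ler_peMl //.
  by move: H cl0 lg ycl lM; clear; lra.
by move: l2g lM; clear; lra.
Qed.

(** Exponent of [n ^ 4 * (1 - p ^ 4) ^ (s * s)]: with [P] for [p ^ 2], the product [P * S] is at
    least [l ^ 2 / 40], and its square outweighs the logarithm. *)
Lemma dense_linking_exponent (c l y x P S : R) : 0 <= c -> 40 * 40 * (4 * c + 1) <= l ->
  y <= c * l -> 0 <= P -> 0 <= x -> l ^+ 4 <= x * P ->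
  x / (40 * l ^+ 2) <= S -> y * 4 - P ^+ 2 * (S * S) <= - l.
Proof.
move=> c0 bl ycl P0 x0 lP xS; have [lg cl0 _ l2g] := dense_sqr_ge c0 bl.
have l20 : 0 < l ^+ 2 by move: l2g; clear; lra.
have C3 : l ^+ 2 / 40 <= P * S.
  apply: (@le_trans _ _ (P * (x / (40 * l ^+ 2)))); last by rewrite ler_wpM2l.
  have -> : P * (x / (40 * l ^+ 2)) = x * P / (40 * l ^+ 2).
    by rewrite mulrCA mulrA.
  have l40 : 0 < 40 * l ^+ 2 by rewrite mulr_gt0.
  rewrite ler_pdivlMr //.
  by have -> : l ^+ 2 / 40 * (40 * l ^+ 2) = l ^+ 4 by field.
have l40 : 0 <= l ^+ 2 / 40 by rewrite divr_ge0 // ltW.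
have C4 : (l ^+ 2 / 40) * (l ^+ 2 / 40) <= (P * S) * (P * S).
  by apply: ler_pM => //; exact: C3.
have C5 : (l ^+ 2 / 40) * (l ^+ 2 / 40) = l ^+ 4 / (40 * 40) by field.
have C6 : (P * S) * (P * S) = P ^+ 2 * (S * S) by ring.
have [_] := dense_quartic_ge c0 bl; move: cl0 lg ycl C4 C5 C6; clear; lra.
Qed.

(** Exponent of [n * p ^ h.-1]. The variable stands for [h.-1]: one unit is lost in halving [n] and
    one in the predecessor. *)
Lemma dense_degree_exponent (c l y x h : R) : 0 <= c -> 40 * 40 * (4 * c + 1) <= l ->
  y <= c * l -> l ^+ 4 <= x -> x / 2 - 2 <= h -> y - 1 / 100 * h <= - l.
Proof.
move=> c0 bl ycl lx xh; have [lg cl0 _ _] := dense_sqr_ge c0 bl.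
have [_] := dense_quartic_ge c0 bl.
by move: cl0 lg ycl lx xh; clear; lra.
Qed.

(** [m] exceeds [l ^ 2] to make cliques unlikely, and [s] is about [n / (20 * l ^ 2)], so that
    [(m + 2) * s] is at most [n / 10] and fits into half of the vertices with [n %/ 8] to spare. *)
Lemma dense_sizes (c l : R) n (m := (Num.trunc (l ^+ 2)).+1)
    (s := Num.trunc (n%:R / (20 * l ^+ 2))) :
  0 <= c -> 40 * 40 * (4 * c + 1) <= l -> l ^+ 4 <= n%:R ->
  [/\ l ^+ 2 <= m%:R <= l ^+ 2 + 1, n%:R / (40 * l ^+ 2) <= s%:R,
      s%:R * 2 <= n%:R :> R & ((m + 2) * s + n %/ 8 <= n./2)%N].
Proof.
move=> c0 bl lx; have [_ _ _ l2g] := dense_sqr_ge c0 bl.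
have l20 : 0 < l ^+ 2 by move: l2g; clear; lra.
have l_neq0 : l != 0 by rewrite -sqrf_eq0 gt_eqF.
have xl0 : 0 <= n%:R / (20 * l ^+ 2) by rewrite divr_ge0 // mulr_ge0 // ltW.
have /andP[m_lb m_ub] := truncn_itv (ltW l20).
have /andP[s_ub s_lb] := truncn_itv xl0; rewrite -/s in s_ub s_lb.
rewrite -(natr1 s) in s_lb.
have mR : m%:R = (Num.trunc (l ^+ 2))%:R + 1 :> R by rewrite /m -natr1.
rewrite -/m in m_ub.
have lx2 : l ^+ 2 * l ^+ 2 <= n%:R by rewrite -exprD.
have l40 : 40 * l ^+ 2 <= l ^+ 2 * l ^+ 2.
  by rewrite ler_wpM2r ?(ltW l20) //; move: l2g; clear; lra.
have x_ge : 40 * 40 <= n%:R :> R by move: lx2 l40 l2g; clear; lra.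
have E : n%:R / (20 * l ^+ 2) = n%:R / (40 * l ^+ 2) + n%:R / (40 * l ^+ 2).
  by field; exact: l_neq0.
have s0 : 0 <= s%:R :> R by rewrite ler0n.
have s10 : (m%:R + 2) * s%:R <= n%:R / 10 :> R.
  have -> : n%:R / 10 = 2 * l ^+ 2 * (n%:R / (20 * l ^+ 2)).
    by field; exact: l_neq0.
  apply: ler_pM => //.
  by move: m_lb mR l2g; clear; lra.
split.
- apply/andP; split; first exact: ltW.
  by move: m_lb mR; clear; lra.
- have : 1 <= n%:R / (40 * l ^+ 2).
    have l40' : 0 < 40 * l ^+ 2 by rewrite mulr_gt0.
    by rewrite ler_pdivlMr // mul1r (le_trans l40).
  by rewrite E in s_lb; move: s_lb; clear; lra.
- have : 2 * s%:R <= (m%:R + 2) * s%:R :> R by rewrite ler_wpM2r // lerDr ler0n.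
  by move: s10 x_ge; clear; lra.
rewrite -(ler_nat R) natrD natrM natrD.
have := divn_le n (isT : (0 < 8)%N); have := half_ge n.
by move: s10 x_ge; clear; lra.
Qed.

Lemma pr_not_CFS_dense_le n (p c l : R) :
  0 <= p <= 99 / 100 -> (0 < n)%N -> 0 <= c -> ln n%:R <= c * l ->
  l ^+ 4 <= n%:R * p ^+ 2 -> 40 * 40 * (4 * c + 1) <= l ->
  pr p (pairs 'I_n) (fun E => ~ CFS (graph_of E)) <= 4 * expR (- l).
Proof.
move=> /andP[p0 p99] n0 c0 lnx lp bl.
have p1 : p <= 1 by apply: le_trans p99 _; rewrite ler_pdivrMr // mul1r ler_nat.
have p01 : 0 <= p <= 1 by rewrite p0.
set x : R := n%:R in lnx lp *.
have x1 : 1 <= x by rewrite /x ler1n.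
have x0 : 0 < x by apply: lt_le_trans x1.
have lnx0 : 0 <= ln x by apply: ln_ge0.
have p2_1 : 0 <= p ^+ 2 <= 1 by rewrite exprn_ge0 ?exprn_ile1.
have p4_1 : 0 <= p ^+ 4 <= 1 by rewrite exprn_ge0 ?exprn_ile1.
have lx : l ^+ 4 <= x.
  by apply: le_trans lp _; rewrite ler_piMr ?(ltW x0) //; case/andP: p2_1.
have l0 : 0 <= l by move: c0 bl; clear; lra.
have [] := dense_sizes c0 bl lx.
set m := (Num.trunc _).+1; set s := Num.trunc _; set w := (n %/ 8)%N.
set h := n./2 => /andP[m_lb m_ub] s_lb s_ub swh.
pose rho := x ^+ (m + 4) * (1 - p ^+ 2) ^+ w.
have rho0 : 0 <= rho.
  by rewrite mulr_ge0 ?exprn_ge0 ?(ltW x0) // subr_ge0; case/andP: p2_1.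
have x16 : 40 * 40 <= x.
  have [_] := dense_quartic_ge c0 bl.
  have : 0 <= c * l by exact: mulr_ge0.
  by move: c0 bl lx; clear; lra.
have w_lb : x / 16 <= w%:R.
  by have := divn_ge n (isT : (0 < 8)%N); rewrite -/w -/x; move: x16; clear; lra.
(* This bound serves twice: [x] absorbs the factor [2 * s], and [rho <= 1] follows. *)
have xrho : x * rho <= expR (- l).
  rewrite /rho mulrA -exprS; have -> : (m + 4).+1 = (m + 5)%N by rewrite -addnS.
  rewrite expr_expR_ln //.
  apply: (@le_trans _ _ (expR (ln x * (m + 5)%:R) * expR (- (p ^+ 2 * w%:R)))).
    by rewrite ler_wpM2l ?expR_ge0 // expr1B_le_expR.
  rewrite -expRD ler_expR natrD.
  apply: (@dense_expansion_exponent c l _ x) => //.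
    by rewrite lnx0.
    by rewrite m_ub ler0n.
  by case/andP: p2_1.
have rho1 : rho <= 1.
  apply: (@le_trans _ _ (x * rho)); first by rewrite ler_peMl.
  by apply: le_trans xrho _; rewrite -expR0 ler_expR oppr_le0.
have T1 : s%:R * rho *+ 2 <= expR (- l).
  by apply: le_trans xrho; rewrite -mulrnAl ler_wpM2r // -mulr_natr.
have pE k : p ^+ k <= expR (- (1 / 100 * k%:R)).
  apply: (@le_trans _ _ ((1 - 1 / 100) ^+ k)).
    by rewrite lerXn2r ?nnegrE //; move: p99; clear; lra.
  by apply: expr1B_le_expR; clear; lra.
have T2 : x ^+ m * p ^+ 'C(m, 2) <= expR (- l).
  apply: (@le_trans _ _ (expR (ln x * m%:R) * expR (- (1 / 100 * 'C(m, 2)%:R)))).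
    by rewrite expr_expR_ln // ler_wpM2l ?expR_ge0.
  rewrite -expRD ler_expR natr_bin2.
  have -> : ln x * m%:R - 1 / 100 * (m%:R * (m%:R - 1) / 2) =
     - (m%:R * ((m%:R - 1) / 200 - ln x)) by field.
  by rewrite lerN2 (@dense_clique_exponent c).
have T3 : x ^+ 4 * (1 - p ^+ 4) ^+ (s * s) <= expR (- l).
  apply: (@le_trans _ _ (expR (ln x * 4%:R) * expR (- (p ^+ 4 * (s * s)%:R)))).
    by rewrite expr_expR_ln // ler_wpM2l ?expR_ge0 // expr1B_le_expR.
  rewrite -expRD ler_expR natrM (exprM p 2 2).
  by apply: (dense_linking_exponent c0 bl lnx _ _ lp); rewrite ?exprn_ge0 // ltW.
have T4 : x * p ^+ h.-1 <= expR (- l).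
  apply: (@le_trans _ _ (expR (ln x) * expR (- (1 / 100 * h.-1%:R)))).
    by rewrite lnK // ler_wpM2l // ltW.
  rewrite -expRD ler_expR; apply: (dense_degree_exponent c0 bl lnx lx).
  have := half_ge n; rewrite -/h -/x => xh.
  have : h%:R - 1 <= h.-1%:R :> R.
    by case: (h) => [|h']; [rewrite sub0r lerN10 | rewrite -(natr1 h') addrK].
  by move: xh; clear; lra.
have [X [hX hcX]] := balanced_set 'I_n; rewrite card_ord -/h in hX hcX.
have h0 : (0 < h)%N.
  rewrite -(ltr_nat R); have := half_ge n; rewrite -/h -/x.
  by move: x16; clear; lra.
have := pr_not_CFS_dense p01 (isT : (0 < m)%N) h0 hX hcX swh.
rewrite card_ord -/x -/rho => /(_ rho1) H; apply: le_trans H _.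
by move: T1 T2 T3 T4; clear; lra.
Qed.

(** * Estimates for [p] close to 1, then for small [p] *)

Lemma bin2_ge (n h : nat) (a : R) : 0 < a -> 0 <= a * n%:R <= h%:R - 1 ->
  a ^+ 2 / 2 * n%:R ^+ 2 <= 'C(h, 2)%:R.
Proof.
move=> a0 /andP[an0 anh]; rewrite natr_bin2.
have -> : a ^+ 2 / 2 * n%:R ^+ 2 = (a * n%:R) * (a * n%:R) / 2 by field.
rewrite ler_pM2r ?invr_gt0 //; apply: ler_pM => //.
by apply: le_trans anh _; rewrite gerBl.
Qed.

Lemma eighth_power_ge (t : R) : 40 * 50 <= t -> 40 * 50 * t <= t ^+ 8 /\ 40 * 50 * t <= t ^+ 2.
Proof.
move=> tb; have t0 : 0 <= t by apply: le_trans tb; rewrite mulr_ge0.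
have t1 : 1 <= t by move: tb; clear; lra.
have H : 40 * 50 * t <= t ^+ 2 by rewrite expr2 ler_wpM2r.
split=> //; apply: le_trans H _; exact: ler_weXn2l.
Qed.

(** Here [t] is the eighth root of [n]: the hypothesis on [t ^ 14] reads [1 - p >= n ^ (- 7 / 4)]
    and makes [(1 - p) * n ^ 2] at least [t ^ 2]. *)
Lemma pr_not_CFS_codense_le n (p t : R) :
  99 / 100 <= p <= 1 -> n%:R = t ^+ 8 -> ln n%:R <= 8 * t ->
  1 <= (1 - p) * t ^+ 14 -> 40 * 50 <= t ->
  pr p (pairs 'I_n) (fun E => ~ CFS (graph_of E)) <= 4 * expR (- t).
Proof.
move=> /andP[p99 p1] xt lnx qt tb.
have [t8 t2] := eighth_power_ge tb; rewrite -xt in t8.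
have t0 : 0 < t by move: tb; clear; lra.
have p0 : 0 <= p by apply: le_trans p99; rewrite divr_ge0.
have p01 : 0 <= p <= 1 by rewrite p0.
have q01 : 0 <= 1 - p <= 1 by rewrite subr_ge0 p1 gerBl.
have x0 : 0 < n%:R :> R by rewrite xt exprn_gt0.
pose y := n./2; pose h := (n %/ 4)%N.
have y_lb := half_ge n; rewrite -/y in y_lb.
have y_ub : y%:R <= n%:R / 2 :> R by rewrite /y -divn2; apply: divn_le.
have h_lb : n%:R / 4 - 1 <= h%:R :> R by apply: divn_ge.
have h_ub : h%:R <= n%:R / 4 :> R by apply: divn_le.
have x16 : 40 * 40 <= n%:R :> R by move: t8 tb; clear; lra.
have yh : (y + h + 4 <= n)%N.
  by rewrite -(ler_nat R) !natrD; move: y_ub h_ub x16; clear; lra.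
have x4 : n%:R ^+ 4 = expR (ln n%:R * 4%:R) :> R by rewrite expr_expR_ln.
have C1 : p ^+ 'C(h, 2) <= expR (- (t ^+ 2 / 50)).
  have -> : p ^+ 'C(h, 2) = (1 - (1 - p)) ^+ 'C(h, 2) by rewrite opprB addrC subrK.
  apply: le_trans (expr1B_le_expR _ q01) _; rewrite ler_expR lerN2.
  (* As [h] is about [n / 4], [h - 1] is still at least [n / 5]. *)
  have B : (1 / 5) ^+ 2 / 2 * n%:R ^+ 2 <= 'C(h, 2)%:R :> R.
    by apply: bin2_ge => //; move: x16 h_lb; clear; lra.
  apply: (@le_trans _ _ ((1 - p) * ((1 / 5) ^+ 2 / 2 * n%:R ^+ 2))); last first.
    by rewrite ler_wpM2l //; case/andP: q01.
  have -> : (1 - p) * ((1 / 5) ^+ 2 / 2 * n%:R ^+ 2) = (1 - p) * t ^+ 14 * (t ^+ 2 / 50).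
    by rewrite xt; field.
  by rewrite ler_peMl // divr_ge0 // sqr_ge0.
have T1 : n%:R ^+ 4 * p ^+ 'C(h, 2) <= expR (- t).
  apply: (@le_trans _ _ (expR (ln n%:R * 4%:R) * expR (- (t ^+ 2 / 50)))).
    by rewrite x4 ler_wpM2l ?expR_ge0.
  by rewrite -expRD ler_expR; move: lnx t2 tb; clear; lra.
have T2 : p ^+ 'C(h, 2) <= expR (- t).
  by apply: le_trans C1 _; rewrite ler_expR; move: t2 tb; clear; lra.
have T3 : n%:R ^+ 4 * (2 ^+ n * (1 - p ^+ 4) ^+ y) <= 2 * expR (- t).
  have p2 : 98 / 100 <= p ^+ 2.
    apply: (@le_trans _ _ ((99 / 100) ^+ 2)); first by clear; lra.
    by rewrite lerXn2r ?nnegrE // divr_ge0.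
  have p4 : 1 - p ^+ 4 <= 1 / 25.
    have : (98 / 100) ^+ 2 <= (p ^+ 2) ^+ 2.
      by rewrite lerXn2r ?nnegrE ?sqr_ge0 // divr_ge0.
    by rewrite -exprM; clear; lra.
  have p4_0 : 0 <= 1 - p ^+ 4 by rewrite subr_ge0 exprn_ile1.
  (* The union over [2 ^ n] sets costs [4 ^ y] up to a factor 2, since [y] is half of [n]; the
     probability is at most [(1 / 25) ^ y]. *)
  have n2 : 2 ^+ n <= 2 * 4 ^+ y :> R.
    have -> : 2 * 4 ^+ y = 2 ^+ (2 * y).+1 :> R.
      by rewrite exprS exprM expr2 -natrM.
    apply: ler_weXn2l; first by rewrite ler1n.
    by rewrite -{1}(odd_double_half n) mul2n -add1n leq_add2r leq_b1.
  have q4 : 2 ^+ n * (1 - p ^+ 4) ^+ y <= 2 * expR (- (21 / 25 * y%:R)).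
    apply: (@le_trans _ _ (2 * 4 ^+ y * (1 / 25) ^+ y)).
      apply: ler_pM; rewrite ?exprn_ge0 //.
      by rewrite lerXn2r ?nnegrE // divr_ge0.
    rewrite -mulrA -exprMn ler_wpM2l //.
    have -> : 4 * (1 / 25) = 1 - 21 / 25 :> R by field.
    by apply: expr1B_le_expR; clear; lra.
  apply: (@le_trans _ _ (expR (ln n%:R * 4%:R) * (2 * expR (- (21 / 25 * y%:R))))).
    by rewrite x4 ler_wpM2l ?expR_ge0.
  rewrite mulrCA ler_wpM2l // -expRD ler_expR.
  by move: lnx y_lb t8 tb; clear; lra.
have := @pr_not_CFS_codense R 'I_n p p01 h y; rewrite card_ord => /(_ yh) H.
apply: le_trans H _; rewrite mulrDr; move: T1 T2 T3; clear; lra.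
Qed.

(** With [n = t ^ 8] the cubic term is [((1 - p) * t ^ 14) ^ 2 / t ^ 4]. The exponential is small
    because [(1 - p) * n ^ 2] diverges in the theorem. *)
Lemma pr_not_CFS_comatching_le n (p t : R) :
  0 <= p <= 1 -> n%:R = t ^+ 8 -> (1 - p) * t ^+ 14 <= 1 -> 40 * 50 <= t ->
  pr p (pairs 'I_n) (fun E => ~ CFS (graph_of E)) <=
  t^-1 + 2 * expR (- ((1 - p) * n%:R ^+ 2 / 32)).
Proof.
move=> p01 xt qt tb; have /andP[p0 p1] := p01.
have [t8 _] := eighth_power_ge tb; rewrite -xt in t8.
have t0 : 0 < t by move: tb; clear; lra.
have t1 : 1 <= t by move: tb; clear; lra.
have q01 : 0 <= 1 - p <= 1 by rewrite subr_ge0 p1 gerBl.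
have [X [hX hcX]] := balanced_set 'I_n; rewrite card_ord in hX hcX.
apply: le_trans (pr_not_CFS_comatching p01 hX hcX) _; rewrite card_ord.
apply: lerD.
  have -> : n%:R ^+ 3 * (1 - p) ^+ 2 = ((1 - p) * t ^+ 14) ^+ 2 / t ^+ 4.
    by rewrite xt; field; rewrite gt_eqF.
  apply: (@le_trans _ _ (1 / t ^+ 4)).
    rewrite ler_pM2r ?invr_gt0 ?exprn_gt0 // exprn_ile1 // mulr_ge0 //.
      by case/andP: q01.
    by rewrite exprn_ge0 // ltW.
  rewrite div1r lef_pV2 ?posrE ?exprn_gt0 // -[leLHS]expr1.
  exact: ler_weXn2l.
rewrite -mulr_natl ler_wpM2l //.
have -> : p ^+ 'C(n./2, 2) = (1 - (1 - p)) ^+ 'C(n./2, 2) by rewrite opprB addrC subrK.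
apply: le_trans (expr1B_le_expR _ q01) _; rewrite ler_expR lerN2 -mulrA.
rewrite ler_wpM2l //; first by case/andP: q01.
have -> : n%:R ^+ 2 / 32 = (1 / 4) ^+ 2 / 2 * n%:R ^+ 2 :> R by field.
have := half_ge n; have : 40 * 40 <= n%:R :> R by move: t8 tb; clear; lra.
by move=> x16 hl; apply: bin2_ge => //; move: x16 hl; clear; lra.
Qed.

(** The power of [n] in the first moment is [4 + k - 2 * k * (1 / 2 + eps) = 4 - 2 * k * eps], which
    is at most [-1]. *)
Lemma pr_CFS_sparse_le n k (p eps : R) : (4 + k <= n)%N -> (0 < n)%N ->
  0 <= p <= 1 -> p <= n%:R `^ (- 2^-1 - eps) -> 5 <= 2 * k%:R * eps ->
  pr p (pairs 'I_n) (fun E => CFS (graph_of E)) <= 2 ^+ 'C(4 + k, 2) / n%:R.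
Proof.
move=> kn n0 p01 pn ke; have /andP[p0 _] := p01.
have x0 : 0 < n%:R :> R by rewrite ltr0n.
have := @pr_CFS_sparse R 'I_n p p01 k; rewrite card_ord => /(_ kn) H.
apply: le_trans H _; rewrite mulrCA ler_wpM2l ?exprn_ge0 //.
apply: (@le_trans _ _ (n%:R ^+ (4 + k) * (n%:R `^ (- 2^-1 - eps)) ^+ (2 * k))).
  by rewrite ler_wpM2l ?exprn_ge0 ?(ltW x0) // lerXn2r ?nnegrE ?powR_ge0.
rewrite -!powR_mulrn ?powR_ge0 ?(ltW x0) // -powRrM -powRD; last first.
  by rewrite (gt_eqF x0) implybT.
rewrite -[leRHS]powR_inv1 ?(ltW x0) //; apply: ler_powR; first by rewrite ler1n.
by rewrite natrD natrM; move: ke; clear; lra.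
Qed.

(** * Passage to the limit *)

Lemma near_powR_ge (a B : R) : 0 < a -> \forall n \near \oo, B <= n%:R `^ a.
Proof.
move=> a0; near=> n; have [B0|B0] := leP B 0; first exact: le_trans (powR_ge0 _ _).
have -> : B = (B `^ a^-1) `^ a by rewrite -powRrM mulVf ?gt_eqF // powRr1 // ltW.
apply: ge0_ler_powR; rewrite ?nnegrE ?powR_ge0 ?(ltW a0) //.
near: n; exact: nbhs_infty_ger.
Unshelve. all: by end_near. Qed.

Lemma gnp_prob_pr n (p : R) (Q : sgraph 'I_n -> Prop) :
  gnp_prob p Q = pr p (pairs 'I_n) (fun E => Q (graph_of E)).
Proof. by rewrite pr_sum. Qed.

Lemma aas_le (p : nat -> R) (Q : forall n, sgraph 'I_n -> Prop) :
  (forall n, 0 <= p n <= 1) ->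
  (forall eta : R, 0 < eta -> \forall n \near \oo,
     pr (p n) (pairs 'I_n) (fun E => ~ Q n (graph_of E)) <= eta) ->
  aas p Q.
Proof.
move=> hp hQ; apply/cvgrPdist_le => eta /hQ near_eta.
near=> n; rewrite gnp_prob_pr -prC ger0_norm ?pr_ge0 //.
by near: n.
Unshelve. all: by end_near. Qed.

Lemma expRN_le (t eta : R) : 0 < eta -> eta^-1 <= t -> expR (- t) <= eta.
Proof.
move=> e0 te; rewrite expRN -[leRHS]invrK lef_pV2 ?posrE ?expR_gt0 ?invr_gt0 //.
apply: le_trans te _; apply: le_trans (expR_ge1Dx _); by rewrite lerDr.
Qed.

End Estimates.

Theorem mainTheorem2 (R : realType) (p : nat -> R) (eps : R)
    (hp : forall n, 0 <= p n <= 1)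
    (hlim : (1 - p n) * n%:R ^+ 2 @[n --> \oo] --> +oo)
    (heps : 0 < eps) :
  ((\forall n \near \oo, n%:R `^ (- 2^-1 + eps) < p n) ->
     aas p (fun n G => CFS G)) /\
  ((\forall n \near \oo, p n < n%:R `^ (- 2^-1 - eps)) ->
     aas p (fun n G => ~ CFS G)).
Proof.
split=> hpn; apply: aas_le => // eta eta0.
  (* [c] comes from [ln n <= (2 / eps) * n ^ (eps / 2)]; the summand [4 / eta] makes [expR (- l)] at
     most [eta / 4]. *)
  pose c := 2 / eps; pose B := 40 * 40 * (4 * c + 1) + 4 / eta.
  have c0 : 0 <= c by rewrite divr_ge0 // ltW.
  have e2 : 0 < eps / 2 by rewrite divr_gt0.
  near=> n.
  have n0 : (0 < n)%N by near: n; exists 1%N.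
  have x0 : 0 < n%:R :> R by rewrite ltr0n.
  pose l : R := n%:R `^ (eps / 2); pose t : R := n%:R `^ 8^-1.
  have eighth : 0 < 8^-1 :> R by rewrite invr_gt0.
  have lB : B <= l by rewrite /l; near: n; apply: near_powR_ge.
  have tB : 40 * 50 + 4 / eta <= t by rewrite /t; near: n; apply: near_powR_ge.
  have iB : 32 * (4 / eta) <= (1 - p n) * n%:R ^+ 2.
    by near: n; move/cvgryPge: hlim; apply.
  have pn : n%:R `^ (- 2^-1 + eps) < p n by near: n.
  have /andP[p0 p1] := hp n.
  have i0 : 0 < 4 / eta by rewrite divr_gt0.
  have i2 : 4 / eta = (eta / 4)^-1 by rewrite invf_div.
  have eta4 : 0 < eta / 4 by rewrite divr_gt0.
  have xt : n%:R = t ^+ 8.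
    by rewrite /t -powR_mulrn ?powR_ge0 // -powRrM mulVf // powRr1 // ltW.
  have tb : 40 * 50 <= t by move: tB i0; clear; lra.
  have et : expR (- t) <= eta / 4.
    by apply: expRN_le => //; rewrite -i2; move: tB; clear; lra.
  have [p99|p99] := leP (p n) (99 / 100).
    have lnx : ln n%:R <= c * l.
      by apply: le_trans (ln_le_powR x0 e2) _; rewrite invf_div.
    have lb : 40 * 40 * (4 * c + 1) <= l by move: lB i0; rewrite /B; clear; lra.
    (* The lower bound on [p] makes [n * p ^ 2] at least [n ^ (2 * eps)], which is [l ^ 4]. *)
    have lp : l ^+ 4 <= n%:R * p n ^+ 2.
      apply: (@le_trans _ _ (n%:R * (n%:R `^ (- 2^-1 + eps)) ^+ 2)); last first.
        by rewrite ler_wpM2l ?(ltW x0) // lerXn2r ?nnegrE ?powR_ge0 // ltW.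
      rewrite -(powR_mulrn 2) ?powR_ge0 // -powRrM -(powR_mulrn 4) ?powR_ge0 //.
      rewrite /l -powRrM -[X in _ <= X * _]powRr1 ?(ltW x0) // -powRD; last first.
        by rewrite (gt_eqF x0) implybT.
      by have -> : eps / 2 * 4%:R = 1 + (- 2^-1 + eps) * 2%:R by field.
    apply: le_trans (pr_not_CFS_dense_le _ n0 c0 lnx lp lb) _; first by rewrite p0.
    have : expR (- l) <= eta / 4.
      apply: expRN_le => //; rewrite -i2; move: lB; rewrite /B.
      by move: c0; clear; lra.
    by clear; lra.
  have [qt|/ltW qt] := leP 1 ((1 - p n) * t ^+ 14).
    have lnx : ln n%:R <= 8 * t.
      by apply: le_trans (ln_le_powR x0 eighth) _; rewrite invrK.
    apply: le_trans (pr_not_CFS_codense_le _ xt lnx qt tb) _.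
      by rewrite p1 ltW.
    by move: et; clear; lra.
  apply: le_trans (pr_not_CFS_comatching_le (hp n) xt qt tb) _.
  have : t^-1 <= eta / 4.
    rewrite -[leRHS]invrK -i2 lef_pV2 ?posrE //; last by move: tb; clear; lra.
    by move: tB; clear; lra.
  have : expR (- ((1 - p n) * n%:R ^+ 2 / 32)) <= eta / 4.
    apply: expRN_le => //; rewrite -i2; move: iB; clear; lra.
  by move: eta4; clear; lra.
(* A constant [k] with [2 * k * eps >= 5], so that the first moment is of order [1 / n]. *)
pose k := (Num.trunc (5 / (2 * eps))).+1.
have ke : 5 <= 2 * k%:R * eps.
  have := truncnS_gt (5 / (2 * eps)); rewrite -/k ltr_pdivrMr ?mulr_gt0 //.
  by move/ltW; rewrite mulrCA mulrA.
near=> n.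
have kn : (4 + k <= n)%N by near: n; exists (4 + k)%N.
have n0 : (0 < n)%N by apply: leq_trans kn.
have x0 : 0 < n%:R :> R by rewrite ltr0n.
have pn : p n < n%:R `^ (- 2^-1 - eps) by near: n.
have xB : 2 ^+ 'C(4 + k, 2) / eta <= n%:R.
  by near: n; exact: nbhs_infty_ger.
apply: (@le_trans _ _ (pr (p n) (pairs 'I_n) (fun E => CFS (graph_of E)))).
  by apply: pr_le => // E _ /contrapT.
apply: le_trans (pr_CFS_sparse_le kn n0 (hp n) (ltW pn) ke) _.
by rewrite ler_pdivrMr // mulrC -ler_pdivrMr.
Unshelve. all: by end_near. Qed.
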